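(* Let $a>0$ be a fixed real number. Let $(N(t),t\ge0)$ be a process of non-negative integer-valued random variables on a probability space $(\Omega,\mathcal{F},\mathbb{P})$, let $Z$ be an almost surely positive random variable, and let $c(\cdot)$ be a positive function with $c(t)\to\infty$ as $t\to\infty$. Let $\mathbb{X}=(X_n,n\ge 1)$ be a strictly stationary sequence of random variables on $(\Omega,\mathcal{F},\mathbb{P})$ and let $(k_n,n\ge1)$ be a sequence of integers with $1\le k_n\le n$ for all $n$ and $\lim_{n\to\infty}k_n/n=1$. Assume that $$\mathbb{P}\big(X_1=\gamma_1(X_1|\mathcal{I}^{\mathbb{X}})\big)=0\quad\text{and}\quad\mathbb{P}\big(X_1=\gamma_1(X_1|\mathcal{I}^{\mathbb{X}})-a\big)=0,$$ and put $$L=I\big(\gamma_1(X_1|\mathcal{I}^{\mathbb{X}})<\infty\big)\cdot\mathbb{P}\big(X_1>\gamma_1(X_1|\mathcal{I}^{\mathbb{X}})-a\,\big|\,\mathcal{I}^{\mathbb{X}}\big).$$ (i) If $N(t)/c(t)\to Z$ almost surely (respectively, in probability) as $t\to\infty$, then $\mathcal{K}_t(k_{N(t)},a)/c(t)\to Z\cdot L$ almost surely (respectively, in probability) as $t\to\infty$. (ii) If $N(t)/c(t)\to Z$ in distribution as $t\to\infty$, then $\mathcal{K}_t(k_{N(t)},a)/c(t)\to Z\cdot L$ in distribution as $t\to\infty$, provided that $L$ is degenerate. If in turn $Z$ is degenerate, then $N(t)/c(t)\to Z$ in distribution implies $N(t)/c(t)\to Z$ in probability and hence $\mathcal{K}_t(k_{N(t)},a)/c(t)\to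 Z\cdot L$ in probability.
   Context: $\mathcal{I}^{\mathbb{X}}$ is the sigma-field of sets invariant with respect to $\mathbb{X}$, i.e. of all $A\subseteq\Omega$ for which there is a Borel set $B\in\mathcal{B}(\mathbb{R}^{\mathbb{N}})$ with $A=\{\omega\in\Omega:(X_i(\omega),X_{i+1}(\omega),\ldots)\in B\}$ for every $i\ge1$. An extended random variable is a measurable function with values in $[-\infty,\infty]$; the usual conventions $x\pm\infty=\pm\infty$, $x<\infty$ for $x\in\mathbb{R}$ apply. For a (real-valued) random variable $X$ on $(\Omega,\mathcal{F},\mathbb{P})$ and a sigma-field $\mathcal{G}\subseteq\mathcal{F}$, the conditional right endpoint of the support of $X$ given $\mathcal{G}$, denoted $\gamma_1(X|\mathcal{G})$, is an extended random variable $\underline{Q}_1$ such that (i) $\underline{Q}_1$ is $\mathcal{G}$-measurable; (ii) $\mathbb{P}(X\le\underline{Q}_1|\mathcal{G})=1$ a.s.; (iii) for any $\mathcal{G}$-measurable extended random variable $Q_1$ with $\mathbb{P}(X\le Q_1|\mathcal{G})=1$ a.s., one has $Q_1\ge\underline{Q}_1$ a.s. It exists and is unique up to almost sure equality. $X_{1:n}\le\cdots\le X_{n:n}$ are the order statistics of $X_1,\ldots,X_n$, and $\mathcal{K}_t(k_{N(t)},a)=\sum_{i=1}^{N(t)} I(X_{k_{N(t)}:N(t)}-a<X_i<X_{k_{N(t)}:N(t)})$, where $I(\cdot)$ is the indicator function and an empty sum (the case $N(t)=0$) equals $0$. A random variable is degenerate if it is almost surely constant. For almost sure convergence and convergence in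 probability, $Z$ is defined on $(\Omega,\mathcal{F},\mathbb{P})$. No independence between $(N(t))$ and $\mathbb{X}$ is assumed. *)

(* Defs.v *)
From HB Require Import structures.
From mathcomp Require Import all_boot all_order all_algebra.
From mathcomp Require Import all_classical all_reals all_analysis.
From mathcomp Require Import measurable_realfun.

Set Implicit Arguments.
Unset Strict Implicit.
Unset Printing Implicit Defensive.

Import Order.TTheory GRing.Theory Num.Theory.
Import numFieldNormedType.Exports.

Local Open Scope classical_set_scope.
Local Open Scope ring_scope.

(* Borel sigma-algebra of R^N, for the product topology. *)
Definition borel_seq (R : realType) : set (set (nat -> R)) :=
  <<s (@open (prod_topology (fun _ : nat => R))) >>.

(* A sequence (X_n, n >= 1) is encoded as X : nat -> T -> R; the value X 0 is
   never used. tail_seq X i w is the real sequence (X_i(w), X_{i+1}(w), ...). *)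
Definition tail_seq (T : Type) (R : realType) (X : nat -> T -> R) (i : nat)
    (w : T) : nat -> R :=
  fun j => X (i + j)%N w.

Definition strictly_stationary d (T : measurableType d) (R : realType)
    (P : probability T R) (X : nat -> T -> R) : Prop :=
  forall (k : nat) (B : set (nat -> R)), borel_seq B ->
    P (tail_seq X k.+1 @^-1` B) = P (tail_seq X 1 @^-1` B).

Definition invariant_sets (T : Type) (R : realType) (X : nat -> T -> R) :
    set (set T) :=
  [set A | exists2 B : set (nat -> R), borel_seq B &
     forall i : nat, (1 <= i)%N -> A = tail_seq X i @^-1` B].

(* Sub-sigma-algebras are plain set systems G : set (set T), so that
   measurability with respect to G is spelled out. *)
Definition measurable_wrt (T : Type) d' (U : measurableType d')
    (G : set (set T)) (f : T -> U) : Prop :=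
  forall B : set U, measurable B -> G (f @^-1` B).

(* p is a version of the conditional probability P(A | G); in particular
   "P(A | G) = 1 a.s." says that the constant 1 is such a version. *)
Definition is_cond_prob d (T : measurableType d) (R : realType)
    (P : probability T R) (G : set (set T)) (A : set T) (p : T -> R) : Prop :=
  [/\ measurable_wrt G p,
      P.-integrable setT (EFin \o p) &
      forall B, G B -> (\int[P]_(w in B) (p w)%:E = P (A `&` B))%E].

(* q is a version of the conditional right endpoint gamma_1(X | G). *)
Definition is_cond_right_endpoint d (T : measurableType d) (R : realType)
    (P : probability T R) (G : set (set T)) (X : T -> R) (q : T -> \bar R) :
    Prop :=
  [/\ measurable_wrt G q,
      is_cond_prob P G [set w | (X w)%:E <= q w]%E (cst 1) &
      forall q' : T -> \bar R, measurable_wrt G q' ->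
        is_cond_prob P G [set w | (X w)%:E <= q' w]%E (cst 1) ->
        {ae P, forall w, (q w <= q' w)%E}].

(* x_{k:n}, the k-th smallest among x_1, ..., x_n, for 1 <= k <= n. *)
Definition order_stat (R : realType) (x : nat -> R) (k n : nat) : R :=
  nth 0 (sort <=%R [seq x i | i <- iota 1 n]) k.-1.

Definition near_count (R : realType) (x : nat -> R) (k n : nat) (a : R) : nat :=
  (\sum_(1 <= i < n.+1)
     (order_stat x k n - a < x i < order_stat x k n)%R)%N.

(* K_t(k_{N(t)}, a) *)
Definition near_count_process (T : Type) (R : realType) (X : nat -> T -> R)
    (N : R -> T -> nat) (k : nat -> nat) (a t : R) (w : T) : nat :=
  near_count (fun i => X i w) (k (N t w)) (N t w) a.

Definition degenerate d (T : measurableType d) (R : realType)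
    (P : probability T R) (Y : T -> R) : Prop :=
  exists l : R, {ae P, forall w, Y w = l}.

Definition cvg_as d (T : measurableType d) (R : realType)
    (P : probability T R) (Y : R -> T -> R) (Z : T -> R) : Prop :=
  {ae P, forall w, Y t w @[t --> +oo] --> Z w}.

Definition cvg_prob d (T : measurableType d) (R : realType)
    (P : probability T R) (Y : R -> T -> R) (Z : T -> R) : Prop :=
  forall e : R, 0 < e ->
    P [set w | e <= `|Y t w - Z w|] @[t --> +oo] --> 0%E.

(* The limit may live on another probability space. *)
Definition cvg_distr d (T : measurableType d) d' (T' : measurableType d')
    (R : realType) (P : probability T R) (P' : probability T' R)
    (Y : R -> T -> R) (Z : T' -> R) : Prop :=
  let F (x : R) := P' (Z @^-1` `]-oo, x]) in
  forall x : R, {for x, continuous F} ->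
    P (Y t @^-1` `]-oo, x]) @[t --> +oo] --> F x.

(* Main.v *)
Require Import Defs.
From HB Require Import structures.
From mathcomp Require Import all_boot all_order all_algebra.
From mathcomp Require Import all_classical all_reals all_analysis.
From mathcomp Require Import measurable_realfun.
From mathcomp Require Import ring lra.

(** Write [g] for the conditional right endpoint, [K n] for the number of
    observations near the order statistic of rank [k n] among the first [n].
    The heart of the proof is that [K n / n] tends almost surely to
    [L = 1_(g < oo) P(X_1 > g - a | I)] ([near_count_frequency_ae]); the limit
    theorems for the random index [N t] follow from it, because
    [K (N t) / c t = (N t / c t) * (K (N t) / N t)].

    For the almost sure limit, let [u m] be invariant functions increasing
    strictly to [g]: [g - 1/(m+1)] where [g] is finite, [m] where it is not.
    By minimality of [g], a positive proportion of the observations exceeds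
    [u m]; as [k n / n] tends to 1, the order statistic eventually lies between
    [u m] and [g]. As neither [g] nor [g - a] is charged, the proportions of
    observations above [u m], and of those between [u m - a] and [g - a], are
    asymptotically small for large [m]. Hence [K n / n] has the same limit as
    the proportion of observations above [g - a] ([near_count_cvg]), which is
    the conditional probability by the pointwise ergodic theorem. Where [g]
    is infinite nothing exceeds [g - a], so this limit is 0 there.

    All the ergodic input is one maximal inequality ([maximal_visits]): if [A]
    is invariant and every orbit in [A] has some average of visits to [E]
    above [b], then [b * P A <= P (E `&` A)]. It gives the convergence of visit
    frequencies to a given conditional probability ([visits_cond_prob]), the
    vanishing of the frequencies of a decreasing sequence of sets with null
    intersection ([often_vanishing]) and the positivity statement
    ([rare_measure]). These are proved for a measure-preserving map with
    strictly invariant sets, and applied to the pairs (outcome, time) with the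
    sigma-algebra generated by the tails ([orbit_space]), whose shift-invariant
    measurable sets are exactly the invariant events of the sequence.

    For the random index, almost sure convergence is composition of limits.
    In probability, [N t] exceeds any [m] with probability close to 1, and
    beyond a large [m] all the [K n / n] are close to [L] at once
    ([random_index_prob]). In distribution, with [L = l] constant, Slutsky's
    lemma compares [K (N t) / c t] with [l * N t / c t]. *)

Set Implicit Arguments.
Unset Strict Implicit.
Unset Printing Implicit Defensive.

Import Order.TTheory GRing.Theory Num.Theory.
Import numFieldNormedType.Exports.

Local Open Scope classical_set_scope.
Local Open Scope ring_scope.

(** * Borel structure of the space of real sequences *)

Definition seq_space (R : realType) :=
  g_sigma_algebraType (@open (prod_topology (fun _ : nat => R))).

HB.instance Definition _ (R : realType) := Measurable.on (seq_space R).

Section seq_space_measurability.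
Context {R : realType}.
Implicit Types (x : nat -> R) (s : seq (rat * rat)).

Definition box s : set (nat -> R) :=
  [set x | forall j, (j < size s)%N ->
     ratr (nth (0, 0) s j).1 < x j < ratr (nth (0, 0) s j).2].

(** Were no rational box around [x] inside [U], points outside [U] could be
    picked in boxes that shrink to [x] and involve more and more coordinates;
    they would converge to [x] coordinatewise, that is, in the product
    topology, contradicting the openness of [U]. *)
Lemma open_box (U : set (prod_topology (fun _ : nat => R))) x :
  open U -> U x -> exists s, box s x /\ box s `<=` U.
Proof.
move=> oU Ux.
have bnd (n j : nat) : exists qr : rat * rat,
    (x j - n.+1%:R^-1 < ratr qr.1 < x j) /\ (x j < ratr qr.2 < x j + n.+1%:R^-1).
  have [q]: exists q, ratr q \in `]x j - n.+1%:R^-1, x j[.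
    by apply: rat_in_itvoo; rewrite ltrBlDr ltrDl invr_gt0.
  rewrite in_itv/= => qP.
  have [r]: exists r, ratr r \in `]x j, x j + n.+1%:R^-1[.
    by apply: rat_in_itvoo; rewrite ltrDl invr_gt0.
  by rewrite in_itv/= => rP; exists (q, r).
pose b n j := sval (cid (bnd n j)).
have bP n j := svalP (cid (bnd n j)).
apply: contrapT => /forallNP nU.
have esc n : exists y, box (mkseq (b n) n) y /\ ~ U y.
  apply: contrapT => /forallNP H; apply: (nU (mkseq (b n) n)); split.
    move=> j; rewrite size_mkseq => jn; rewrite nth_mkseq//.
    by have [/andP[_ ->] /andP[-> _]] := bP n j.
  by move=> y yb; apply: contrapT => nUy; exact: (H y).
pose y n : prod_topology (fun _ : nat => R) := sval (cid (esc n)).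
have yP n := svalP (cid (esc n)).
have yx : y @ \oo --> (x : prod_topology (fun _ : nat => R)).
  apply/cvg_sup => j U' [V] [[W] oW <-] WxN WU.
  apply: (filterS WU); rewrite nbhs_simpl /=.
  have : y n j @[n --> \oo] --> x j.
    apply/cvgrPdist_lt => e e0; near=> n.
    have jn : (j < n)%N by near: n; exact: nbhs_infty_gt.
    have ne : n.+1%:R^-1 < e by near: n; exact: near_infty_natSinv_lt (PosNum e0).
    have [yb _] := yP n.
    have := yb j; rewrite size_mkseq => /(_ jn); rewrite nth_mkseq//.
    have [/andP[b1 b2] /andP[b3 b4]] := bP n j.
    move=> /andP[y1 y2]; apply: le_lt_trans ne.
    rewrite -/(b n j) in b1 b2 b3 b4.
    rewrite ler_norml; apply/andP; split.
      rewrite lerBrDl lerBlDr; apply: (le_trans (ltW y2)); exact: ltW.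
    by rewrite lerBlDr -lerBlDl; apply: ltW; apply: lt_trans y1.
  by move=> /(_ W); apply; apply: open_nbhs_nbhs; split.
have /yx : nbhs (x : prod_topology (fun _ : nat => R)) U.
  exact: open_nbhs_nbhs.
by move=> -[n _ /(_ n (leqnn n))]; exact: (yP n).2.
Unshelve. all: by end_near. Qed.

(** There are countably many rational boxes, so every open set is a countable
    union of cylinders, and the Borel sets of the product are generated by
    the coordinates. *)
Lemma measurable_fun_seq d (T : measurableType d) (f : T -> seq_space R) :
  (forall j, measurable_fun setT (fun w => f w j)) -> measurable_fun setT f.
Proof.
move=> mf; apply: (@measurability _ _ T (seq_space R) setT f
  (@open (prod_topology (fun _ : nat => R))) erefl).
move=> _ [U oU <-]; rewrite setTI.
have -> : f @^-1` U = \bigcup_(s in [set s | box s `<=` U]) (f @^-1` box s).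
  apply/seteqP; split=> [w /= /(open_box oU)[s [sw sU]]|w [s /= sU /sU//]].
  by exists s.
rewrite bigcup_mkcond; apply: countable_bigcupT_measurable => // s.
case: ifPn => // _.
have -> : f @^-1` box s = \bigcap_(j < size s)
    (fun w => f w j) @^-1` `]ratr (nth (0, 0) s j).1, ratr (nth (0, 0) s j).2[.
  by apply/seteqP; split=> w /= wb j /wb/=; rewrite in_itv.
apply: bigcap_measurableType => j _; rewrite -[X in measurable X]setTI.
by apply: mf => //; exact: measurable_itv.
Qed.

Lemma measurable_coord j : measurable_fun setT (fun x : seq_space R => x j).
Proof.
apply: (measurability _ (RGenOInfty.measurableE R)) => //.
move=> _ [_ [r ->] <-]; rewrite setTI; apply: sub_sigma_algebra.
have cj : continuous (fun x : prod_topology (fun _ : nat => R) => x j : R).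
  by move=> x; exact: (@proj_continuous nat (fun=> R) j x).
by move/continuousP : cj; apply; exact: interval_open.
Qed.

End seq_space_measurability.

(** * The maximal ergodic inequality *)

Section visit_frequencies.
Context {d : measure_display} {S : measurableType d} {R : realType}.
Variables (P : probability S R) (theta : S -> S).
Hypothesis mtheta : measurable_fun setT theta.
Hypothesis Ptheta : forall A, measurable A -> P (theta @^-1` A) = P A.
Implicit Types (A E : set S) (b e : R).

Definition visits E n x : nat := (\sum_(0 <= j < n) (iter j theta x \in E))%N.

Lemma visitsSl E n x :
  visits E n.+1 x = ((x \in E) + visits E n (theta x))%N.
Proof.
rewrite /visits big_nat_recl//; congr (_ + _)%N.
by apply: eq_bigr => j _; rewrite -iterSr.
Qed.

Lemma visitsSr E n x :
  visits E n.+1 x = (visits E n x + (iter n theta x \in E))%N.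
Proof. by rewrite /visits big_nat_recr. Qed.

Lemma visitsC E n x : (visits (~` E) n x + visits E n x = n)%N.
Proof.
rewrite /visits -big_split/= -[RHS]subn0 -[RHS]muln1 -sum_nat_const_nat.
by apply: eq_bigr => j _; rewrite in_setC; case: (_ \in _).
Qed.

Lemma visits_shift E n x : `|(visits E n (theta x))%:R - (visits E n x)%:R| <= 1 :> R.
Proof.
have := visitsSl E n x; rewrite visitsSr.
have := leq_b1 (x \in E); have := leq_b1 (iter n theta x \in E).
case: (_ \in _) => _; case: (_ \in _) => _ /=; rewrite ?addn0 ?add0n ?addn1 ?add1n.
- by move=> [->]; rewrite subrr normr0.
- by move=> <-; rewrite -natr1 addrAC subrr add0r normr1.
- by move=> ->; rewrite -natr1 opprD addrA subrr add0r normrN normr1.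
- by move=> ->; rewrite subrr normr0.
Qed.

Lemma measurable_iter j : measurable_fun setT (iter j theta).
Proof.
elim: j => [|j IH]; first exact: measurable_id.
exact: (measurableT_comp mtheta IH).
Qed.

Lemma measurable_visits E n : measurable E ->
  measurable_fun setT (fun x => (visits E n x)%:R : R).
Proof.
move=> mE.
have -> : (fun x => (visits E n x)%:R : R) =
    (fun x => \sum_(0 <= j < n) \1_E (iter j theta x)).
  by apply/funext => x; rewrite /visits natr_sum; apply: eq_bigr => j _; rewrite indicE.
apply: measurable_sum => j; apply: measurableT_comp (measurable_iter j).
exact: measurable_indic.
Qed.

(** Garsia's functional: the maximum of 0 and of the partial sums of [f] over
    the first [1], ..., [n] points of the orbit of [x], written as a recursion
    along the orbit. *)
Fixpoint max_excess (f : S -> R) n x : R :=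
  if n is n'.+1 then Num.max 0 (f x + max_excess f n' (theta x)) else 0.

Lemma max_excessS f n x :
  max_excess f n.+1 x = Num.max 0 (f x + max_excess f n (theta x)).
Proof. by []. Qed.

Lemma max_excess_ge0 f n x : 0 <= max_excess f n x.
Proof. by case: n => //= n; rewrite le_max lexx. Qed.

Lemma max_excess_nondecreasing f n x : max_excess f n x <= max_excess f n.+1 x.
Proof.
elim: n x => [|n IH] x; first exact: max_excess_ge0.
by rewrite [leLHS]/= [leRHS]/= ge_max !le_max lexx/= lerD2l IH orbT.
Qed.

Lemma max_excess_le f n x : (forall y, f y <= 1) -> max_excess f n x <= n%:R.
Proof.
move=> f1; elim: n x => //= n IH x.
by rewrite ge_max ler0n/= -natr1 addrC lerD.
Qed.

Lemma measurable_max_excess f n : measurable_fun setT f ->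
  measurable_fun setT (max_excess f n).
Proof.
move=> mf; elim: n => [|n IH]; first exact: measurable_cst.
apply: measurable_maxr => //; apply: measurable_funD => //.
exact: (measurableT_comp IH mtheta).
Qed.

(** Garsia's argument for [f = 1_E - b] on the invariant set [A]. On the set
    [G n] where [M_n = max_excess f n] is positive, [M_n <= f + M_n \o theta],
    so [M_n + b 1_(G n) <= 1_(E `&` G n) + M_n \o theta] everywhere. As [theta]
    preserves [P], the integrals of [M_n] and [M_n \o theta] cancel, and the
    sets [G n] increase to [A]. All terms are kept nonnegative, so that no
    integrability question arises. *)
Lemma maximal_visits E A b : measurable E -> measurable A ->
  theta @^-1` A = A -> 0 <= b ->
  (forall x, A x -> exists n, b * n%:R < (visits E n x)%:R) ->
  (b%:E * P A <= P (E `&` A))%E.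
Proof.
move=> mE mA iA b0 hA.
pose f x := (\1_E x - b) * \1_A x : R.
have mf : measurable_fun setT f.
  apply: measurable_funM; last exact: measurable_indic.
  by apply: measurable_funB => //; exact: measurable_indic.
have f1 y : f y <= 1.
  rewrite /f !indicE; case: (y \in E); case: (y \in A); rewrite /=; lra.
have iAE y : (theta y \in A) = (y \in A).
  by rewrite -[in RHS]iA; apply/idP/idP => /set_mem yA; apply/mem_set.
have Moff n x : x \notin A -> max_excess f n x = 0.
  elim: n x => //= n IH x xA.
  rewrite IH ?iAE// /f !indicE (negbTE xA) mulr0 addr0; exact/max_idPl.
have Mon n x : x \in A -> (visits E n x)%:R - b * n%:R <= max_excess f n x.
  elim: n x => [|n IH] x xA; first by rewrite /visits big_geq// mulr0 subrr.
  rewrite visitsSl natrD -natr1 max_excessS le_max; apply/orP; right.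
  have := IH (theta x); rewrite iAE => /(_ xA).
  rewrite {2}/f !indicE xA mulr1; lra.
pose G n := [set x | 0 < max_excess f n x].
have mM n : measurable_fun setT (max_excess f n) by exact: measurable_max_excess.
have mG n : measurable (G n).
  rewrite -[G n]setTI; have -> : G n = max_excess f n @^-1` `]0, +oo[.
    by apply/seteqP; split => x; rewrite /G/= in_itv/= andbT.
  by apply: mM => //; exact: measurable_itv.
have GA n : G n `<=` A.
  move=> x; rewrite /G/= => Mx; apply/set_mem; apply: contraLR Mx => /Moff ->.
  by rewrite ltxx.
have AG : \bigcup_n G n = A.
  apply/seteqP; split=> [x [n _ /GA]//|x Ax].
  have [n hn] := hA x Ax; exists n => //; rewrite /G/=.
  by apply: lt_le_trans (Mon n x (mem_set Ax)); rewrite subr_gt0.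
have ndG : nondecreasing_seq G.
  apply/nondecreasing_seqP => n; apply/subsetPset => x.
  rewrite /G/= => /lt_le_trans; apply.
  exact: max_excess_nondecreasing.
have key n x : max_excess f n x + b * \1_(G n) x <=
    \1_(E `&` G n) x + max_excess f n (theta x).
  have [xG|xG] := boolP (x \in G n); last first.
    rewrite !indicE in_setI (negbTE xG) andbF mulr0 addr0/= add0r.
    have := xG; rewrite notin_setE /G/= => /negP; rewrite -leNgt => /le_trans; apply.
    exact: max_excess_ge0.
  have xA : x \in A by apply/mem_set/(GA n)/set_mem.
  rewrite !indicE in_setI xG andbT mulr1.
  have {xG} M0 : 0 < max_excess f n x by exact: set_mem xG.
  case: n {mM mG ndG AG GA} M0 => [|n]; first by rewrite /= ltxx.
  rewrite !(max_excessS f n x) => M0.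
  have -> : Num.max 0 (f x + max_excess f n (theta x)) =
      f x + max_excess f n (theta x).
    by apply/max_idPr/ltW; move: M0; rewrite lt_max ltxx.
  have Mn := max_excess_nondecreasing f n (theta x).
  rewrite {1}/f !indicE xA mulr1; lra.
have step n : (b%:E * P (G n) <= P (E `&` A))%E.
  have mEG : measurable (E `&` G n) by exact: measurableI.
  have PEGA : (P (E `&` G n) <= P (E `&` A))%E.
    by apply: le_measure; rewrite ?inE//; [exact: measurableI|exact: setIS].
  apply: le_trans PEGA.
  have mME : measurable_fun setT (EFin \o max_excess f n) by apply/measurable_EFinP.
  have Ifin : (\int[P]_x (max_excess f n x)%:E)%E \is a fin_num.
    rewrite ge0_fin_numE; last first.
      by apply: integral_ge0 => x _; rewrite lee_fin max_excess_ge0.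
    apply: (@le_lt_trans _ _ (\int[P]_x (cst n%:R%:E x))%E).
      apply: ge0_le_integral => //.
      - by move=> x _; rewrite lee_fin max_excess_ge0.
      - by move=> x _; rewrite /cst lee_fin; exact: max_excess_le.
    by rewrite integral_cst// [X in (_ * X)%E](probability_setT P) mule1 ltry.
  rewrite -(leeD2lE _ _ Ifin).
  have Ishift : (\int[P]_x (max_excess f n x)%:E =
                 \int[P]_x (max_excess f n (theta x))%:E)%E.
    rewrite -(@ge0_integral_pushforward _ _ _ _ R _ mtheta P setT
      (fun x => (max_excess f n x)%:E))//; last first.
      by move=> x _; rewrite lee_fin max_excess_ge0.
    by apply: eq_measure_integral => B mB _; exact: esym (Ptheta mB).
  have mind B : measurable B -> measurable_fun setT (EFin \o \1_B : S -> \bar R).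
    by move=> mB; apply/measurable_EFinP; exact: measurable_indic.
  have -> : (\int[P]_x (max_excess f n x)%:E + b%:E * P (G n) =
      \int[P]_x ((max_excess f n x)%:E + b%:E * (\1_(G n) x)%:E))%E.
    rewrite ge0_integralD//=.
    - by rewrite ge0_integralZl//= ?integral_indic ?setIT//; exact: mind.
    - by move=> x _; rewrite lee_fin max_excess_ge0.
    - by move=> x _; rewrite mule_ge0.
    - by apply: measurable_funeM; exact: mind.
  have -> : (\int[P]_x (max_excess f n x)%:E + P (E `&` G n) =
      \int[P]_x ((\1_(E `&` G n) x)%:E + (max_excess f n (theta x))%:E))%E.
    rewrite ge0_integralD//=.
    - by rewrite integral_indic// setIT -Ishift addeC.
    - exact: mind.
    - by move=> x _; rewrite lee_fin max_excess_ge0.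
    - by apply/measurable_EFinP; exact: (measurableT_comp (mM n) mtheta).
  apply: ge0_le_integral => //=.
  - by move=> x _; rewrite adde_ge0 ?lee_fin ?max_excess_ge0// mulr_ge0.
  - by apply: emeasurable_funD => //; apply: measurable_funeM; exact: mind.
  - apply: emeasurable_funD; first exact: mind.
    by apply/measurable_EFinP; exact: (measurableT_comp (mM n) mtheta).
  - by move=> x _; rewrite -EFinM -!EFinD lee_fin.
have cvgG : P (G n) @[n --> \oo] --> P A.
  rewrite -AG; apply: nondecreasing_cvg_mu => //.
  by rewrite AG.
have cvgbG := cvgeZl (erefl _ : b%:E \is a fin_num) cvgG.
by apply: (cvge_to_le cvgbG); exact: nearW.
Qed.

End visit_frequencies.

Lemma ex_natSinv_lt (R : realType) (e : R) : 0 < e -> exists r, r.+1%:R^-1 < e.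
Proof.
move=> e0; have [r _ /(_ r (leqnn r)) hr] := near_infty_natSinv_lt (PosNum e0).
by exists r.
Qed.

(** * Asymptotic frequencies of visits *)

Section limsup_frequency.
Context {d : measure_display} {S : measurableType d} {R : realType}.
Variables (P : probability S R) (theta : S -> S).
Hypothesis mtheta : measurable_fun setT theta.
Hypothesis Ptheta : forall A, measurable A -> P (theta @^-1` A) = P A.
Implicit Types (A E : set S) (b e : R).

Local Notation visits := (visits theta).

(** The set where the limsup of the frequencies of visits to [E] exceeds [b],
    spelled with countable operations only: the margin [r.+1%:R^-1] makes the
    strict inequality survive the error of one visit caused by a shift. *)
Definition often E b : set S :=
  \bigcup_r \bigcap_m \bigcup_(n in [set n | (m <= n)%N])
    [set x | (b + r.+1%:R^-1) * n%:R <= (visits E n x)%:R].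

Lemma measurable_often E b : measurable E -> measurable (often E b).
Proof.
move=> mE; apply: bigcupT_measurable => r; apply: bigcapT_measurable => m.
apply: bigcup_measurable => n _.
have -> : [set x | (b + r.+1%:R^-1) * n%:R <= (visits E n x)%:R] =
    (fun x => (visits E n x)%:R) @^-1` `[(b + r.+1%:R^-1) * n%:R, +oo[.
  by apply/seteqP; split => x /=; rewrite in_itv/= andbT.
rewrite -[X in measurable X]setTI; apply: measurable_visits => //.
Qed.

(** Shifting the starting point changes the number of visits by at most 1,
    which the gap between two consecutive margins absorbs for large [n]. The
    invariance is exact, not merely almost sure. *)
Lemma often_invariant E b : theta @^-1` often E b = often E b.
Proof.
pose g r : R := r.+1%:R^-1 - r.+2%:R^-1.
have g0 r : 0 < g r by rewrite subr_gt0 ltf_pV2 ?posrE// ltr_nat.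
have step (x y : S) : (forall n, (visits E n x)%:R - 1 <= (visits E n y)%:R :> R) ->
    often E b x -> often E b y.
  move=> xy [r _ hr]; exists r.+1 => // m _.
  have [n /= mn hn] := hr (maxn m (Num.bound (g r)^-1)) I.
  exists n; first by apply: leq_trans mn; exact: leq_maxl.
  apply: le_trans (xy n); rewrite lerBrDr; apply: le_trans hn.
  have gn : 1 <= g r * n%:R.
    rewrite -ler_pdivrMl// mulr1; apply: ltW.
    apply: lt_le_trans (archi_boundP _) _; first by rewrite invr_ge0 ltW.
    rewrite ler_nat.
    by apply: leq_trans mn; exact: leq_maxr.
  move: gn; rewrite /g; set u := r.+1%:R^-1; set v := r.+2%:R^-1; set k := n%:R.
  by rewrite !mulrDl mulNr; lra.
apply/seteqP; split => x /=; apply: step => n;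
  have := visits_shift (R := R) theta E n x; rewrite ler_norml; lra.
Qed.

Lemma often_excess E b x : often E b x -> exists n, b * n%:R < (visits E n x)%:R.
Proof.
move=> [r _ /(_ 1%N I)[n /= n1 hn]]; exists n; apply: lt_le_trans hn.
by rewrite ltr_pM2r ?ltr0n// ltrDl invr_gt0.
Qed.

Lemma often_measure E A b : measurable E -> measurable A ->
  theta @^-1` A = A -> A `<=` often E b -> 0 <= b ->
  (b%:E * P A <= P (E `&` A))%E.
Proof.
move=> mE mA iA Ao b0; apply: (maximal_visits mtheta Ptheta) => // x /Ao.
exact: often_excess.
Qed.

Lemma not_often E b e x : ~ often E b x -> 0 < e ->
  \forall n \near \oo, (visits E n x)%:R <= (b + e) * n%:R.
Proof.
move=> no e0.
have [r re] := ex_natSinv_lt e0.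
have /existsNP[m /not_implyP[_ hm]] : ~ forall m, True -> exists2 n, (m <= n)%N &
    (b + r.+1%:R^-1) * n%:R <= (visits E n x)%:R.
  by move=> h; apply: no; exists r.
near=> n; have mn : (m <= n)%N by near: n; exact: nbhs_infty_ge.
apply: ltW; apply: (@lt_le_trans _ _ ((b + r.+1%:R^-1) * n%:R)).
  by rewrite ltNge; apply/negP => hn; apply: hm; exists n.
by rewrite ler_wpM2r// lerD2l ltW.
Unshelve. all: by end_near. Qed.

(** On the invariant set where every [E m] has limsup frequency above [b > 0],
    the maximal inequality bounds [b * P A] by [P (E m)], which tends to 0. *)
Lemma often_vanishing (E : nat -> set S) :
  (forall m, measurable (E m)) -> (forall m, E m.+1 `<=` E m) ->
  P (\bigcap_m E m) = 0%E ->
  {ae P, forall x, forall e, 0 < e ->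
     exists m, \forall n \near \oo, (visits (E m) n x)%:R <= e * n%:R}.
Proof.
move=> mE dE PE0.
pose A r := \bigcap_m often (E m) (r.+1%:R^-1 : R).
have mA r : measurable (A r).
  by apply: bigcapT_measurable => m; exact: measurable_often.
have iA r : theta @^-1` (A r) = A r.
  by rewrite preimage_bigcap; apply: eq_bigcapr => m _; exact: often_invariant.
have PA r : P (A r) = 0%E.
  have niE : nonincreasing_seq E.
    by apply/nonincreasing_seqP => m; apply/subsetPset.
  have cE : P (E m) @[m --> \oo] --> 0%E.
    rewrite -PE0; apply: nonincreasing_cvg_mu => //.
      by apply: le_lt_trans (probability_le1 P (mE 0%N)) _; rewrite ltry.
    exact: bigcapT_measurable.
  have : (r.+1%:R^-1%:E * P (A r) <= 0)%E.
    apply: (cvge_ge _ cE); apply: nearW => m.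
    have Am : A r `<=` often (E m) r.+1%:R^-1 by move=> x; apply.
    apply: (le_trans (often_measure (mE m) (mA r) (iA r) Am _)) => //.
    by apply: le_measure; rewrite ?inE//; exact: measurableI.
  rewrite pmule_rle0 ?lte_fin ?invr_gt0// => PA0.
  by apply/eqP; rewrite eq_le PA0/= measure_ge0.
have /ae_foralln : forall r, {ae P, forall x, ~ A r x}.
  move=> r; exists (A r); split => // x /=; exact: contrapT.
apply: filterS => x xA e e0.
have [r re] := ex_natSinv_lt e0.
have /existsNP[m /not_implyP[_ hm]] := xA r.
exists m; have e20 : 0 < e - r.+1%:R^-1 by rewrite subr_gt0.
have := not_often hm e20; apply: filterS => n.
by rewrite addrC subrK.
Qed.

(** The points whose orbit visits [E] with liminf frequency 0, seen through
    the visits to the complement. *)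
Definition rare E : set S := \bigcap_r often (~` E) (1 - r.+1%:R^-1).

Lemma measurable_rare E : measurable E -> measurable (rare E).
Proof.
by move=> mE; apply: bigcapT_measurable => r; apply/measurable_often/measurableC.
Qed.

Lemma rare_invariant E : theta @^-1` rare E = rare E.
Proof.
by rewrite preimage_bigcap; apply: eq_bigcapr => r _; exact: often_invariant.
Qed.

(** The maximal inequality for the complement of [E] gives
    [(1 - 1/r) * P A <= P (A minus E)] for every [r], where [A = rare E]. *)
Lemma rare_measure E : measurable E -> P (E `&` rare E) = 0%E.
Proof.
move=> mE; have mr := measurable_rare mE.
have mEr : measurable (E `&` rare E) by exact: measurableI.
have mCr : measurable (~` E `&` rare E) by apply: measurableI => //; exact: measurableC.
have fr B : measurable B -> (P B = (fine (P B))%:E)%E.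
  by move=> mB; rewrite fineK// fin_num_measure.
have split_r : (P (rare E) = P (E `&` rare E) + P (~` E `&` rare E))%E.
  rewrite -measureU//.
    by rewrite -setIUl setUv setTI.
  by rewrite setIACA setICr set0I.
have hr r : ((1 - r.+1%:R^-1)%:E * P (rare E) <= P (~` E `&` rare E))%E.
  apply: often_measure => //; first exact: measurableC.
  - exact: rare_invariant.
  - by move=> x; apply.
  - by rewrite subr_ge0 invf_le1// ler1n.
move: split_r hr; rewrite (fr _ mr) (fr _ mEr) (fr _ mCr).
set q := fine (P (E `&` _)); set q' := fine (P (rare _)); set q'' := fine _.
rewrite -EFinD => -[split_r] hr.
have {}hr r : (1 - r.+1%:R^-1) * q' <= q'' by rewrite -lee_fin EFinM.
have q0 : 0 <= q by rewrite fine_ge0.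
have q'0 : 0 <= q' by rewrite fine_ge0.
congr (_%:E); apply/eqP; rewrite eq_le q0 andbT leNgt; apply/negP => qp.
have e0 : 0 < q / (q' + 1) by rewrite divr_gt0// ltr_pwDr.
have [r] := ex_natSinv_lt e0; rewrite ltr_pdivlMr ?ltr_pwDr// => rlt.
have := hr r; have : 0 < r.+1%:R^-1 :> R by rewrite invr_gt0.
move: rlt; rewrite split_r; set u := r.+1%:R^-1; lra.
Qed.

Lemma not_rare E x : ~ rare E x -> exists2 e : R, 0 < e &
  \forall n \near \oo, e * n%:R <= (visits E n x)%:R.
Proof.
move=> /existsNP[r /not_implyP[_ hr]].
have r0 : 0 < r.+1%:R^-1 / 2 :> R by rewrite divr_gt0// invr_gt0.
exists (r.+1%:R^-1 / 2) => //.
have := not_often hr r0; apply: filterS => n.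
have := visitsC theta E n x => /(congr1 (fun k => k%:R : R)); rewrite natrD.
set u := r.+1%:R^-1; lra.
Qed.

(** Half of the pointwise ergodic theorem. For rationals [q1 < q2], on
    [A = {p < q1, limsup > q2}] one has
    [q2 * P A <= P (E `&` A) = \int_A p <= q1 * P A], hence [P A = 0]. The same
    comparison with [b = 0] shows that [p] is almost surely nonnegative, so
    that only [q2 >= 0] is needed. *)
Lemma visits_le_cond_prob E (p : S -> R) : measurable E ->
  measurable_fun setT p -> p \o theta = p -> P.-integrable setT (EFin \o p) ->
  (forall A, measurable A -> theta @^-1` A = A ->
     (\int[P]_(x in A) (p x)%:E = P (E `&` A))%E) ->
  {ae P, forall x, forall e, 0 < e ->
     \forall n \near \oo, (visits E n x)%:R <= (p x + e) * n%:R}.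
Proof.
move=> mE mp ip intp hp.
have key A a b : measurable A -> theta @^-1` A = A ->
    (b%:E * P A <= P (E `&` A))%E -> a < b -> (forall x, A x -> p x < a) ->
    P A = 0%E.
  move=> mA iA bA ab pa.
  have paA : (\int[P]_(x in A) (p x)%:E <= a%:E * P A)%E.
    rewrite -integral_cst//; apply: le_integral => //.
    - exact: integrableS intp.
    - by apply: finite_measure_integrable_cst.
    - by move=> x /set_mem /pa; rewrite lee_fin => /ltW.
  rewrite hp// in paA; have := le_trans bA paA.
  rewrite -(@fineK _ (P A)) ?fin_num_measure// -!EFinM lee_fin.
  have q0 : 0 <= fine (P A) by rewrite fine_ge0.
  move=> h; congr (_%:E); nra.
have mpa a : measurable [set x | p x < a].
  rewrite -[X in measurable X]setTI.
  have -> : [set x | p x < a] = p @^-1` `]-oo, a[.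
    by apply/seteqP; split => x /=; rewrite in_itv.
  exact: mp.
have ipa a : theta @^-1` [set x | p x < a] = [set x | p x < a].
  by rewrite -{2}ip.
pose A (q : rat * rat) := [set x | p x < ratr q.1] `&` often E (ratr q.2).
have PA (q : rat * rat) : q.1 < q.2 -> 0 <= q.2 -> P (A q) = 0%E.
  move=> q12 q20; have mo := measurable_often (ratr q.2 : R) mE.
  apply: (@key _ (ratr q.1) (ratr q.2)).
  - exact: measurableI.
  - by rewrite preimage_setI ipa often_invariant.
  - apply: often_measure => //; first exact: measurableI.
    + by rewrite preimage_setI ipa often_invariant.
    + exact: subIsetr.
    + by rewrite ler0q.
  - by rewrite ltr_rat.
  - by move=> x [].
pose B r := [set x | p x < - (r.+1%:R^-1 : R)].
have PB r : P (B r) = 0%E.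
  apply: (@key _ (- r.+1%:R^-1) 0).
  - exact: mpa.
  - exact: ipa.
  - by rewrite mul0e.
  - by rewrite oppr_lt0 invr_gt0.
  - by [].
(* The pairs of rationals are enumerated, so that the null sets [A q] can be
   discarded all at once. *)
pose A' n := if (unpickle n : option (rat * rat)) is Some q then
   if (q.1 < q.2) && (0 <= q.2) then A q else set0 else set0.
have mA q : measurable (A q) by apply: measurableI => //; exact: measurable_often.
have aeB : {ae P, forall x, forall r, ~ B r x}.
  apply: ae_foralln => r; exists (B r).
  by split; [exact: mpa|exact: PB|move=> x /=; exact: contrapT].
have aeA : {ae P, forall x, forall n, ~ A' n x}.
  apply: ae_foralln => n; exists (A' n); rewrite /A'; case: unpickle => [q|]; last first.
    by split => // x /=; exact: contrapT.
  case: ifPn => [/andP[q1 q2]|_]; split => //; last by move=> x; exact: contrapT.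
    exact: PA.
  by move=> x; exact: contrapT.
apply: filterS2 aeA aeB => x xA xB e e0.
have p0 : 0 <= p x.
  rewrite leNgt; apply/negP => px0.
  have px0' : 0 < - p x by rewrite oppr_gt0.
  have [r rlt] := ex_natSinv_lt px0'.
  by apply: (xB r); rewrite /B/= ltrNr.
have e20 : 0 < e / 2 by rewrite divr_gt0.
have [a] : exists a, ratr a \in `]p x, p x + e / 4[.
  by apply: rat_in_itvoo; rewrite ltrDl divr_gt0.
rewrite in_itv/= => /andP[pa ae].
have [q] : exists q, ratr q \in `]p x + e / 4, p x + e / 2[.
  by apply: rat_in_itvoo; rewrite ltrD2l ltr_pM2l// ltf_pV2 ?posrE// ltr_nat.
rewrite in_itv/= => /andP[eb be].
have ab : a < q by rewrite -(ltr_rat R); lra.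
have b0 : 0 <= q by rewrite -(ler0q R); lra.
have no : ~ often E (ratr q) x.
  move=> ox; apply: (xA (pickle (a, q))).
  by rewrite /A' pickleK/= ab b0; split.
have := not_often no e20; apply: filterS => n /le_trans; apply.
by rewrite ler_wpM2r//; lra.
Qed.

(** The lower bound is the upper bound for the complement of [E], whose
    conditional probability is [1 - p]. *)
Lemma visits_cond_prob E (p : S -> R) : measurable E ->
  measurable_fun setT p -> p \o theta = p -> P.-integrable setT (EFin \o p) ->
  (forall A, measurable A -> theta @^-1` A = A ->
     (\int[P]_(x in A) (p x)%:E = P (E `&` A))%E) ->
  {ae P, forall x, (visits E n x)%:R / n%:R @[n --> \oo] --> p x}.
Proof.
move=> mE mp ip intp hp.
have up := visits_le_cond_prob mE mp ip intp hp.
have int1 : P.-integrable setT (EFin \o cst (1 : R)).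
  exact: finite_measure_integrable_cst.
have intq : P.-integrable setT (EFin \o (fun x => 1 - p x)).
  by have := integrableB measurableT int1 intp; apply: eq_integrable.
have lo : {ae P, forall x, forall e, 0 < e ->
     \forall n \near \oo, (visits (~` E) n x)%:R <= (1 - p x + e) * n%:R}.
  apply: visits_le_cond_prob => //.
  - exact: measurableC.
  - by apply: measurable_funB.
  - by apply/funext => x /=; rewrite -[in RHS]ip.
  - move=> A mA iA.
    transitivity (\int[P]_(x in A) ((cst (1%:E : \bar R) \- (EFin \o p)) x))%E.
      by apply: eq_integral.
    rewrite integralB//; last 2 first.
      exact: finite_measure_integrable_cst.
      exact: integrableS intp.
    rewrite integral_cst// mul1e hp//; transitivity (P A - P (E `&` A))%E => //.
    have mEA : measurable (E `&` A) by exact: measurableI.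
    have mCA : measurable (~` E `&` A) by apply: measurableI => //; exact: measurableC.
    have -> : (P A = P (~` E `&` A) + P (E `&` A))%E.
      rewrite -measureU//.
        by rewrite -setIUl setUC setUv setTI.
      by rewrite setIACA [_ `&` E]setIC setICr set0I.
    by rewrite addeK// fin_num_measure.
apply: filterS2 up lo => x up lo.
apply/cvgrPdist_le => e e0.
near=> n.
have n0 : 0 < n%:R :> R by rewrite ltr0n; near: n; exact: nbhs_infty_gt.
have upn : (visits E n x)%:R <= (p x + e) * n%:R by near: n; exact: up.
have lon : (visits (~` E) n x)%:R <= (1 - p x + e) * n%:R by near: n; exact: lo.
have := visitsC theta E n x => /(congr1 (fun k => k%:R : R)); rewrite natrD => sn.
rewrite ler_distl; apply/andP; split; first by rewrite lerBlDr ler_pdivrMr.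
by rewrite -lerBlDr ler_pdivlMr//; lra.
Unshelve. all: by end_near. Qed.

End limsup_frequency.

(** * Observations near an order statistic: the deterministic part *)

Section near_maximum_counts.
Context {R : realType}.
Implicit Types (x : nat -> R) (k n : nat) (a l : R) (v g : \bar R).

Lemma count_iota1 (p : pred nat) n :
  count p (iota 1 n) = (\sum_(0 <= j < n) p j.+1)%N.
Proof.
rewrite -sum1_count big_mkcond/= -[n in iota 1 n]subn0 -subSS.
by rewrite -/(index_iota 1 n.+1) big_add1/=; apply: eq_bigr => j _; case: p.
Qed.

Lemma order_stat_gt x k n v : (1 <= k <= n)%N ->
  (\sum_(0 <= j < n) ((x j.+1)%:E <= v)%E < k)%N ->
  (v < (order_stat x k n)%:E)%E.
Proof.
move=> /andP[k1 kn]; case: v => [r||] h; last exact: ltNyr.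
  rewrite lte_fin; apply: nth_count_gt; first exact/sort_le_sorted.
  rewrite size_sort size_map size_iota prednK// kn andbT.
  rewrite count_sort count_map -ltnS prednK// count_iota1.
  by rewrite (leq_trans _ h)// ltnS; apply: leq_sum => j _; rewrite /= lee_fin.
suff : (n < n)%N by rewrite ltnn.
apply: leq_trans kn; apply: leq_trans h; rewrite ltnS.
under eq_bigr do rewrite leey.
by rewrite sum_nat_const_nat subn0 muln1.
Qed.

Lemma order_stat_mem x k n : (1 <= k <= n)%N ->
  exists j, order_stat x k n = x j.+1.
Proof.
move=> /andP[k1 kn].
have : order_stat x k n \in [seq x i | i <- iota 1 n].
  rewrite /order_stat -(mem_sort <=%R) mem_nth//.
  by rewrite size_sort size_map size_iota prednK.
move=> /mapP[i]; rewrite mem_iota => /andP[i1 _] ->.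
by exists i.-1; rewrite prednK.
Qed.

Lemma near_countE x k n a : near_count x k n a =
  (\sum_(0 <= j < n) (order_stat x k n - a < x j.+1 < order_stat x k n)%R)%N.
Proof. by rewrite /near_count big_add1. Qed.

Lemma near_count_ext x y k n a :
  (forall j, x j.+1 = y j.+1) -> near_count x k n a = near_count y k n a.
Proof.
move=> xy; rewrite !near_countE.
have -> : order_stat x k n = order_stat y k n.
  rewrite /order_stat; congr (nth _ (sort _ _) _); apply/eq_in_map => i.
  by rewrite mem_iota => /andP[i1 _]; rewrite -(prednK i1).
by apply: eq_bigr => j _; rewrite xy.
Qed.

Lemma near_count_le x k n a : (near_count x k n a <= n)%N.
Proof.
rewrite near_countE -[leqRHS]subn0 -[leqRHS]muln1 -sum_nat_const_nat.
by apply: leq_sum => j _; exact: leq_b1.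
Qed.

Let dist_frequency_le (F K A B e N : R) : 0 < N -> K <= F + B -> F <= K + A ->
  A <= e * N -> B <= e * N -> `|F / N - K / N| <= e.
Proof.
move=> N0 KF FK AN BN; rewrite -mulrBl ler_norml; apply/andP; split.
  by rewrite ler_pdivlMr//; lra.
by rewrite ler_pdivrMr//; lra.
Qed.

(** With [y] the order statistic, the thresholds [u m] being exceeded with
    positive frequency while only [o(n)] observations lie above rank [k n],
    eventually [u m < y <= g]. Replacing the window [(y - a, y)] by
    [(g - a, +oo)] adds only observations above [u m] and loses only
    observations in [(u m - a, g - a]]; both have small frequency for
    suitable [m]. *)
Lemma near_count_cvg x (k : nat -> nat) a l g (u : nat -> \bar R) :
  (forall n, (1 <= n)%N -> (1 <= k n <= n)%N) ->
  (k n)%:R / n%:R @[n --> \oo] --> (1 : R) ->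
  (forall j, ((x j.+1)%:E <= g)%E) ->
  (forall m, exists2 e : R, 0 < e & \forall n \near \oo,
     e * n%:R <= (\sum_(0 <= j < n) (u m < (x j.+1)%:E)%E)%N%:R) ->
  (forall e : R, 0 < e -> exists m, \forall n \near \oo,
     (\sum_(0 <= j < n) (u m < (x j.+1)%:E)%E)%N%:R <= e * n%:R) ->
  (forall e : R, 0 < e -> exists m, \forall n \near \oo,
     (\sum_(0 <= j < n) (u m - a%:E < (x j.+1)%:E <= g - a%:E)%E)%N%:R
       <= e * n%:R) ->
  (\sum_(0 <= j < n) (g - a%:E < (x j.+1)%:E)%E)%N%:R / n%:R
    @[n --> \oo] --> l ->
  (near_count x (k n) n a)%:R / n%:R @[n --> \oo] --> l.
Proof.
move=> hk hk1 xg hpos htop hgap hl.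
have gt_u m : \forall n \near \oo, (u m < (order_stat x (k n) n)%:E)%E.
  have [e e0 he] := hpos m.
  near=> n.
  have n0 : (0 < n)%N by near: n; exact: nbhs_infty_gt.
  have n0R : 0 < n%:R :> R by rewrite ltr0n.
  apply: order_stat_gt; first exact: hk.
  have hen : e * n%:R <= (\sum_(0 <= j < n) (u m < (x j.+1)%:E)%E)%N%:R.
    by near: n.
  have kn : 1 - (k n)%:R / n%:R < e.
    apply: le_lt_trans (ler_norm _) _; near: n.
    by move/cvgrPdist_lt : hk1; apply.
  move: kn; rewrite ltrBlDr -ltrBlDl ltr_pdivlMr// => kn.
  rewrite -(ltr_nat R).
  have sumC : (\sum_(0 <= j < n) ((x j.+1)%:E <= u m)%E +
      \sum_(0 <= j < n) (u m < (x j.+1)%:E)%E = n)%N.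
    rewrite -big_split/= -[RHS]subn0 -[RHS]muln1 -sum_nat_const_nat.
    by apply: eq_bigr => j _; rewrite leNgt; case: ltP.
  move: sumC => /(congr1 (fun k => k%:R : R)); rewrite natrD; lra.
apply/cvgrPdist_le => e e0.
have e40 : 0 < e / 2 by rewrite divr_gt0.
have [m3 h3] := htop _ e40.
have [m4 h4] := hgap _ e40.
near=> n.
have n0 : (0 < n)%N by near: n; exact: nbhs_infty_gt.
have n0R : 0 < n%:R :> R by rewrite ltr0n.
have uy3 : (u m3 < (order_stat x (k n) n)%:E)%E by near: n; exact: gt_u.
have uy4 : (u m4 < (order_stat x (k n) n)%:E)%E by near: n; exact: gt_u.
set y := order_stat x (k n) n in uy3 uy4 *.
have yg : (y%:E <= g)%E.
  by have [j] := order_stat_mem x (hk n n0); rewrite -/y => ->.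
have n3 : (\sum_(0 <= j < n) (u m3 < (x j.+1)%:E)%E)%N%:R <= e / 2 * n%:R.
  by near: n.
have n4 : (\sum_(0 <= j < n) (u m4 - a%:E < (x j.+1)%:E <= g - a%:E)%E)%N%:R
       <= e / 2 * n%:R by near: n.
have nl : `|l - (\sum_(0 <= j < n) (g - a%:E < (x j.+1)%:E)%E)%N%:R / n%:R| <= e / 2.
  by near: n; move/cvgrPdist_le : hl; apply.
have upper : (near_count x (k n) n a <=
    \sum_(0 <= j < n) (g - a%:E < (x j.+1)%:E)%E +
    \sum_(0 <= j < n) (u m4 - a%:E < (x j.+1)%:E <= g - a%:E)%E)%N.
  rewrite near_countE -big_split/=; apply: leq_sum => j _.
  rewrite -/y; case: ltP => //= yaj.
  have -> : (u m4 - a%:E < (x j.+1)%:E)%E.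
    apply: (@le_lt_trans _ _ (y - a)%:E); last by rewrite lte_fin.
    by rewrite EFinB leeB// ltW.
  by rewrite leNgt; case: (_ < _)%E; case: (_ < _).
have lower : (\sum_(0 <= j < n) (g - a%:E < (x j.+1)%:E)%E <=
    near_count x (k n) n a + \sum_(0 <= j < n) (u m3 < (x j.+1)%:E)%E)%N.
  rewrite near_countE -big_split/=; apply: leq_sum => j _.
  rewrite -/y; case: ltP => //= gaj.
  have -> : y - a < x j.+1.
    rewrite -lte_fin; apply: le_lt_trans gaj.
    by rewrite EFinD leeD2r.
  have [//|yx] := ltP (x j.+1) y.
  by rewrite (lt_le_trans uy3)// lee_fin.
move: upper lower; rewrite -!(ler_nat R) !natrD => upper lower.
apply: le_trans (ler_distD
  ((\sum_(0 <= j < n) (g - a%:E < (x j.+1)%:E)%E)%N%:R / n%:R) _ _) _.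
by rewrite (splitr e) lerD//; apply: (dist_frequency_le n0R upper lower).
Unshelve. all: by end_near. Qed.

End near_maximum_counts.

(** * Observations near the order statistics along an orbit *)

Section near_count_along_orbits.
Context {d : measure_display} {S : measurableType d} {R : realType}.
Variables (P : probability S R) (theta : S -> S).
Hypothesis mtheta : measurable_fun setT theta.
Hypothesis Ptheta : forall A, measurable A -> P (theta @^-1` A) = P A.

Lemma invariant_iter U (f : S -> U) : f \o theta = f ->
  forall j x, f (iter j theta x) = f x.
Proof. by move=> fi; elim=> //= j IH x; rewrite -[RHS]IH -[in RHS]fi. Qed.

Lemma ae_iter (Q : S -> Prop) : {ae P, forall x, Q x} ->
  {ae P, forall x, forall j, Q (iter j theta x)}.
Proof.
move=> [A [mA PA0 QA]]; apply: ae_foralln => j.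
have mj : measurable (iter j theta @^-1` A).
  by rewrite -[X in measurable X]setTI; exact: measurable_iter.
exists (iter j theta @^-1` A); split => //; last by move=> x /= nQ; exact: QA.
elim: j {mj} => //= j <-.
rewrite -[RHS]Ptheta.
  by congr (P _); apply/seteqP; split => x /=; rewrite -iterSr.
by rewrite -[X in measurable X]setTI; exact: measurable_iter.
Qed.

Lemma ae_notin A : measurable A -> P A = 0%E -> {ae P, forall x, ~ A x}.
Proof. by move=> mA PA0; exists A; split => // x /=; exact: contrapT. Qed.

Variables (X : S -> R) (g : S -> \bar R).
Hypothesis mX : measurable_fun setT X.
Hypothesis mg : measurable_fun setT g.
Hypothesis ig : g \o theta = g.
Hypothesis X_le_g : {ae P, forall x, ((X x)%:E <= g x)%E}.
Hypothesis g_min : forall q : S -> \bar R, measurable_fun setT q ->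
  q \o theta = q -> {ae P, forall x, ((X x)%:E <= q x)%E} ->
  {ae P, forall x, (g x <= q x)%E}.
Hypothesis X_neq_g : P [set x | (X x)%:E = g x] = 0%E.

(** Thresholds increasing strictly to the right endpoint [g], whether it is
    finite or not: this is what lets both cases share one proof. *)
Definition below m (x : S) : \bar R :=
  if g x == +oo%E then (m%:R)%:E else (g x - (m.+1%:R^-1)%:E)%E.

Lemma measurable_below m : measurable_fun setT (below m).
Proof.
apply: measurable_fun_ifT => //; first exact: measurable_fun_eqe.
by apply: emeasurable_funB.
Qed.

Lemma below_invariant m : below m \o theta = below m.
Proof. by apply/funext => x; rewrite /below/= -[g (theta x)]/((g \o theta) x) ig. Qed.

Lemma below_nondecreasing m x : (below m x <= below m.+1 x)%E.
Proof.
rewrite /below; case: ifPn => _; first by rewrite lee_fin ler_nat.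
by rewrite leeB// lee_fin lef_pV2 ?posrE// ler_nat.
Qed.

Lemma below_lt m x : (-oo < g x)%E -> (below m x < g x)%E.
Proof.
rewrite /below; case: ifPn => [/eqP ->|]; first by rewrite ltry.
by case: (g x) => //= r _ _; rewrite lte_fin ltrBlDr ltrDl.
Qed.

Lemma below_cvg x (y : R) : (-oo < g x)%E ->
  (forall m, (below m x < y%:E)%E) -> (g x <= y%:E)%E.
Proof.
move=> gx hy; have [goo|gfin] := eqVneq (g x) +oo%E.
  have := hy (Num.bound `|y|); rewrite /below goo eqxx lte_fin => /ltW.
  by rewrite leNgt (le_lt_trans (ler_norm y) (archi_boundP (normr_ge0 y))).
have {}hy m : (g x - (m.+1%:R^-1)%:E < y%:E)%E.
  by have := hy m; rewrite /below (negbTE gfin).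
case: (g x) gx gfin hy => //= r _ _ hy; rewrite lee_fin leNgt; apply/negP => yr.
have [m] := ex_natSinv_lt (etrans (subr_gt0 _ _) yr).
have := hy m; rewrite -EFinB lte_fin; set v := _^-1; lra.
Qed.

Definition exceeds m : set S := [set x | (below m x < (X x)%:E)%E].

Let mXE : measurable_fun setT (EFin \o X). Proof. exact/measurable_EFinP. Qed.

Lemma measurable_exceeds m : measurable (exceeds m).
Proof.
rewrite -[X in measurable X]setTI; apply: measurable_lte => //.
exact: measurable_below.
Qed.

Lemma g_gtNy : {ae P, forall x, (-oo < g x)%E}.
Proof.
by apply: filterS X_le_g => x; apply: lt_le_trans; rewrite ltNyr.
Qed.

(** Where [exceeds m] is visited with frequency 0, [X <= below m] almost
    surely; lowering [g] to [below m] there would give a smaller invariant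
    upper bound of [X], against the minimality of [g]. *)
Lemma not_rare_exceeds m : {ae P, forall x, ~ rare (R := R) theta (exceeds m) x}.
Proof.
set A := rare (R := R) theta (exceeds m).
have mE := measurable_exceeds m.
have mA : measurable A by exact: measurable_rare.
have iA : theta @^-1` A = A by exact: rare_invariant.
pose q x := if x \in A then below m x else g x.
have qi : q \o theta = q.
  apply/funext => x; rewrite /q/= -[below m (theta x)]/((below m \o theta) x).
  rewrite below_invariant -[g (theta x)]/((g \o theta) x) ig.
  congr (if _ then _ else _); rewrite -[in RHS]iA.
  by apply/idP/idP => /set_mem h; exact/mem_set.
have mq : measurable_fun setT q.
  apply: measurable_fun_ifT => //; last exact: measurable_below.
  apply: (measurable_fun_bool true) => //; rewrite setTI.
  by rewrite (_ : _ @^-1` _ = A)//; apply/seteqP; split=> x /=;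
    [move=> xA; apply/set_mem; rewrite xA|move=> /mem_set ->].
have mEA : measurable (exceeds m `&` A) by exact: measurableI.
have Xq : {ae P, forall x, ((X x)%:E <= q x)%E}.
  have nEA := ae_notin mEA (rare_measure mtheta Ptheta mE).
  apply: filterS2 nEA X_le_g => x nx Xg; rewrite /q; case: ifPn => // /set_mem Ax.
  by rewrite leNgt; apply/negP => bx; apply: nx.
apply: filterS2 (g_min mq qi Xq) g_gtNy => x gq gx Ax.
move: gq; rewrite /q mem_set// => gb.
by have := le_lt_trans gb (below_lt m gx); rewrite ltxx.
Qed.

(** A point of all the sets [exceeds m] satisfies [X >= g], hence [X = g]. *)
Lemma exceeds_vanishing : P (\bigcap_m exceeds m) = 0%E.
Proof.
have mEE : measurable (\bigcap_m exceeds m).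
  by apply: bigcapT_measurable => m; exact: measurable_exceeds.
apply/negligibleP => //.
have mXg : measurable [set x | (X x)%:E = g x].
  by rewrite -[X in measurable X]setTI; exact: measurable_eqe.
have aeX := ae_notin mXg X_neq_g.
have : {ae P, forall x, ~ (\bigcap_m exceeds m) x}.
  apply: filterS3 aeX X_le_g g_gtNy => x nXg Xg gx Ex; apply: nXg.
  apply/eqP; rewrite eq_le Xg/=; apply: below_cvg => // m; exact: Ex.
by move=> [B [mB PB0 sB]]; exists B; split => // x Ex; apply: sB => /=; exact.
Qed.

Variables (a : R) (p : S -> R) (k : nat -> nat).
Hypothesis mp : measurable_fun setT p.
Hypothesis ip : p \o theta = p.
Hypothesis intp : P.-integrable setT (EFin \o p).
Hypothesis p_cond : forall A, measurable A -> theta @^-1` A = A ->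
  (\int[P]_(x in A) (p x)%:E =
     P ([set x | g x - a%:E < (X x)%:E] `&` A))%E.
Hypothesis X_neq_ga : P [set x | (X x)%:E = (g x - a%:E)%E] = 0%E.
Hypothesis hk : forall n, (1 <= n)%N -> (1 <= k n <= n)%N.
Hypothesis hk1 : (k n)%:R / n%:R @[n --> \oo] --> (1 : R).

(** The part of the window lost when [g] replaces a value above [below m]; the
    intersection of these sets is contained in [{X = g - a}]. *)
Definition gap m : set S :=
  [set x | (below m x - a%:E < (X x)%:E <= g x - a%:E)%E].

Let mga : measurable_fun setT (fun x => g x - a%:E)%E.
Proof. exact: emeasurable_funB. Qed.

Lemma measurable_gap m : measurable (gap m).
Proof.
have mba : measurable_fun setT (fun x => below m x - a%:E)%E.
  by apply: emeasurable_funB => //; exact: measurable_below.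
have -> : gap m = [set x | (below m x - a%:E < (X x)%:E)%E] `&`
    [set x | ((X x)%:E <= g x - a%:E)%E].
  by apply/seteqP; split => x /= => [/andP[]|[h1 h2]]; [split|apply/andP].
apply: measurableI; rewrite -[X in measurable X]setTI.
- exact: measurable_lte.
- exact: measurable_lee.
Qed.

Lemma gap_vanishing : P (\bigcap_m gap m) = 0%E.
Proof.
have mG : measurable (\bigcap_m gap m).
  by apply: bigcapT_measurable => m; exact: measurable_gap.
apply/negligibleP => //.
have mXg : measurable [set x | (X x)%:E = (g x - a%:E)%E].
  by rewrite -[X in measurable X]setTI; exact: measurable_eqe.
have : {ae P, forall x, ~ (\bigcap_m gap m) x}.
  apply: filterS2 (ae_notin mXg X_neq_ga) g_gtNy => x nXg gx Gx; apply: nXg.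
  have /andP[_ Xga] := Gx 0%N I.
  apply/eqP; rewrite eq_le Xga andTb leeBlDr//.
  apply: below_cvg => // m; have /andP[+ _] := Gx m I.
  by rewrite lteBlDr.
by move=> [B [mB PB0 sB]]; exists B; split => // x Ex; apply: sB => /=; exact.
Qed.

(** When [g] is infinite, no observation exceeds [g - a]: the frequency of
    [{g - a < X}] is then 0, in accordance with the factor [(g x < +oo)]. *)
Lemma near_count_frequency : {ae P, forall x,
  (near_count (fun i => X (iter i.-1 theta x)) (k n) n a)%:R / n%:R
    @[n --> \oo] --> (g x < +oo)%E%:R * p x}.
Proof.
have mE m := measurable_exceeds m.
have aeE : {ae P, forall x, forall e : R, 0 < e -> exists m, \forall n \near \oo,
     (visits theta (exceeds m) n x)%:R <= e * n%:R}.
  apply: (often_vanishing mtheta Ptheta) => //; last exact: exceeds_vanishing.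
  by move=> m x; apply: le_lt_trans; exact: below_nondecreasing.
have aeG : {ae P, forall x, forall e : R, 0 < e -> exists m, \forall n \near \oo,
     (visits theta (gap m) n x)%:R <= e * n%:R}.
  apply: (often_vanishing mtheta Ptheta); last exact: gap_vanishing.
    exact: measurable_gap.
  move=> m x /andP[bx Xg]; apply/andP; split => //; apply: le_lt_trans bx.
  by rewrite leeB//; exact: below_nondecreasing.
have aeR : {ae P, forall x, forall m, ~ rare (R := R) theta (exceeds m) x}.
  by apply: ae_foralln => m; exact: not_rare_exceeds.
have mU : measurable [set x | (g x - a%:E < (X x)%:E)%E].
  by rewrite -[X in measurable X]setTI; exact: measurable_lte.
have aeU := visits_cond_prob mtheta Ptheta mU mp ip intp p_cond.
have aeX := ae_iter X_le_g.
have gi j x : g (iter j theta x) = g x by exact: invariant_iter.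
have bi m j x : below m (iter j theta x) = below m x.
  by apply: invariant_iter; exact: below_invariant.
apply: filterS2 (filterI aeX aeE) (filterI aeG (filterI aeR aeU)).
move=> x [Xg xE] [xG [xR xU]] {aeX aeE aeG aeR aeU}.
have visitsE (U : set S) n (f : nat -> bool) :
    (forall j, U (iter j theta x) = f j) ->
    visits theta U n x = (\sum_(0 <= j < n) f j)%N.
  move=> Uf; apply: eq_bigr => j _; congr (nat_of_bool _).
  by apply/idP/idP => [/set_mem|fj]; [rewrite Uf|apply/mem_set; rewrite Uf].
pose y i := X (iter i.-1 theta x).
have EE m n : visits theta (exceeds m) n x =
    (\sum_(0 <= j < n) (below m x < (y j.+1)%:E)%E)%N.
  by apply: visitsE => j; rewrite /exceeds/= bi.
have GE m n : visits theta (gap m) n x =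
    (\sum_(0 <= j < n) (below m x - a%:E < (y j.+1)%:E <= g x - a%:E)%E)%N.
  by apply: visitsE => j; rewrite /gap/= bi gi.
have UE n : visits theta [set x | (g x - a%:E < (X x)%:E)%E] n x =
    (\sum_(0 <= j < n) (g x - a%:E < (y j.+1)%:E)%E)%N.
  by apply: visitsE => j; rewrite /= gi.
apply: (@near_count_cvg _ y k a _ (g x) (fun m => below m x)) => //.
- by move=> j; rewrite -(gi j x); exact: Xg.
- move=> m; have [e e0 he] := not_rare (xR m).
  by exists e => //; apply: filterS he => n; rewrite EE.
- move=> e e0; have [m hm] := xE e e0.
  by exists m; apply: filterS hm => n; rewrite EE.
- move=> e e0; have [m hm] := xG e e0.
  by exists m; apply: filterS hm => n; rewrite GE.
- under eq_fun do rewrite -UE.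
  have [goo|gfin] := ltP; first by rewrite mul1r.
  move: gfin; rewrite leye_eq => /eqP goo; rewrite mul0r.
  under eq_fun do rewrite UE goo.
  rewrite (_ : (fun _ => _) = cst 0); first exact: cvg_cst.
  by apply/funext => n; rewrite big1 ?mul0r.
Qed.

End near_count_along_orbits.

(** * A stationary sequence as a measure-preserving system *)

Section orbit_space.
Context {d : measure_display} {T : measurableType d} {R : realType}.
Variables (P : probability T R) (X : nat -> {RV P >-> R}).
Hypothesis X_stationary : strictly_stationary P X.

Definition orbit_map (wi : T * nat) : seq_space R := tail_seq X wi.2.+1 wi.1.

(** The pairs [(w, i)] with the sigma-algebra generated by the tails
    [(X_(i+1) w, X_(i+2) w, ...)], on which [(w, i) |-> (w, i + 1)] acts. A set
    [A] of outcomes is invariant with respect to the sequence exactly when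
    [A * nat] is measurable here, and the sets [A * nat] are exactly the
    shift-invariant ones. Working here rather than on the path space makes
    invariant functions strictly invariant, not only almost surely. *)
Definition orbit_space := g_sigma_algebra_preimageType orbit_map.

HB.instance Definition _ := Measurable.on orbit_space.

Definition orbit_shift (wi : orbit_space) : orbit_space := (wi.1, wi.2.+1).

Definition orbit_section i (w : T) : orbit_space := (w, i).

Lemma measurable_orbitP (E : set orbit_space) :
  measurable E <-> exists2 B, borel_seq B & E = orbit_map @^-1` B.
Proof.
split=> [[B mB <-]|[B mB ->]]; exists B => //; first by rewrite setTI.
by rewrite setTI.
Qed.

Lemma measurable_tail_seq i : measurable_fun setT (tail_seq X i : T -> seq_space R).
Proof. by apply: measurable_fun_seq => j; exact: measurable_funP. Qed.

Lemma measurable_orbit_section i : measurable_fun setT (orbit_section i).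
Proof.
move=> _ E /measurable_orbitP[B mB ->]; rewrite setTI.
by rewrite -[X in measurable X]setTI; exact: (measurable_tail_seq i.+1).
Qed.

Lemma measurable_orbit_map : measurable_fun setT (orbit_map : orbit_space -> seq_space R).
Proof. by move=> _ B mB; rewrite setTI; apply/measurable_orbitP; exists B. Qed.

Lemma measurable_orbit_shift : measurable_fun setT orbit_shift.
Proof.
move=> _ E /measurable_orbitP[B mB ->]; rewrite setTI; apply/measurable_orbitP.
pose tl (x : seq_space R) : seq_space R := fun j => x j.+1.
have mtl : measurable_fun setT tl.
  by apply: measurable_fun_seq => j; exact: measurable_coord.
exists (tl @^-1` B); first by rewrite -[_ @^-1` _]setTI; exact: mtl.
have tlE wi : orbit_map (orbit_shift wi) = tl (orbit_map wi).
  by apply/funext => j; rewrite /orbit_map /tl /tail_seq/= addSnnS.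
by apply/seteqP; split => wi /=; rewrite tlE.
Qed.

HB.instance Definition _ :=
  isMeasurableFun.Build _ _ _ _ (orbit_section 0) (measurable_orbit_section 0).

Definition orbit_law : probability orbit_space R := distribution P (orbit_section 0).

(** Stationarity of the sequence, read on the orbit space. *)
Lemma orbit_law_shift E : measurable E ->
  orbit_law (orbit_shift @^-1` E) = orbit_law E.
Proof. by move=> /measurable_orbitP[B mB ->]; exact: (X_stationary 1 mB). Qed.

Lemma invariant_measurable_orbit A :
  invariant_sets X A -> measurable (fst @^-1` A : set orbit_space).
Proof.
move=> [B mB hA]; apply/measurable_orbitP; exists B => //.
by apply/seteqP; split => -[w i]/=; rewrite (hA i.+1).
Qed.

Lemma measurable_wrt_orbit d' (U : measurableType d') (f : T -> U) :
  measurable_wrt (invariant_sets X) f ->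
  measurable_fun setT (fun wi : orbit_space => f wi.1).
Proof.
move=> mf _ B mB; rewrite setTI.
exact: (invariant_measurable_orbit (mf B mB)).
Qed.

Lemma invariant_orbit_section (E : set orbit_space) : measurable E ->
  orbit_shift @^-1` E = E -> invariant_sets X (orbit_section 0 @^-1` E).
Proof.
move=> /measurable_orbitP[B mB EB] iE; exists B => // -[//|i] _.
rewrite -[RHS]/(orbit_section i @^-1` (orbit_map @^-1` B)) -EB.
elim: i => //= i ->; rewrite -[in LHS]iE.
by [].
Qed.

Lemma orbit_measurable_wrt d' (U : measurableType d') (f : orbit_space -> U) :
  measurable_fun setT f -> f \o orbit_shift = f ->
  measurable_wrt (invariant_sets X) (fun w => f (orbit_section 0 w)).
Proof.
move=> mf fi B mB; apply: (@invariant_orbit_section (f @^-1` B)).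
  by rewrite -[_ @^-1` _]setTI; exact: mf.
by rewrite -[in RHS]fi.
Qed.

Lemma ae_orbit_section (Q : orbit_space -> Prop) :
  {ae orbit_law, forall x, Q x} -> {ae P, forall w, Q (orbit_section 0 w)}.
Proof.
move=> [A [mA PA0 QA]]; exists (orbit_section 0 @^-1` A); split => //.
  by rewrite -[_ @^-1` _]setTI; exact: measurable_orbit_section.
by move=> w /= nQ; exact: QA.
Qed.

Lemma ae_orbit_law (Q : orbit_space -> Prop) : measurable [set x | Q x] ->
  {ae P, forall w, Q (orbit_section 0 w)} -> {ae orbit_law, forall x, Q x}.
Proof.
move=> mQ aeQ; have mnQ : measurable (~` [set x | Q x]) by exact: measurableC.
exists (~` [set x | Q x]); split => //.
suff : P (orbit_section 0 @^-1` ~` [set x | Q x]) = 0%E by [].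
apply/negligibleP => //.
by rewrite -[_ @^-1` _]setTI; exact: measurable_orbit_section.
Qed.

Lemma invariant_setsT : invariant_sets X setT.
Proof. by exists setT => //; exact: (@measurableT _ (seq_space R)). Qed.

Lemma invariant_sets0 : invariant_sets X set0.
Proof. by exists set0 => //; exact: (@measurable0 _ (seq_space R)). Qed.

Lemma invariant_measurable A : invariant_sets X A -> measurable A.
Proof.
move=> [B mB /(_ 1%N isT) ->]; rewrite -[_ @^-1` _]setTI.
exact: measurable_tail_seq.
Qed.

Lemma measurable_wrt_cst d' (U : measurableType d') (y : U) :
  measurable_wrt (invariant_sets X) (cst y : T -> U).
Proof.
move=> B mB; rewrite preimage_cst; case: ifP => _.
  exact: invariant_setsT.
exact: invariant_sets0.
Qed.

(** Testing against the whole space gives one direction; conversely a null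
    complement changes no integral over an invariant set. *)
Lemma cond_prob1P A : measurable A ->
  is_cond_prob P (invariant_sets X) A (cst 1) <-> {ae P, forall w, A w}.
Proof.
have int1 B : measurable B -> (\int[P]_(w in B) (cst 1 w : R)%:E = P B)%E.
  by move=> mB; rewrite -[RHS]mul1e -integral_cst.
move=> mA; split=> [[_ _ /(_ _ invariant_setsT)]|aeA].
  rewrite setIT int1// => PA1.
  exists (~` A); split => //; first exact: measurableC.
  rewrite probability_setC// -PA1 [X in (_ - X)%E](@probability_setT _ _ _ P).
  by rewrite subee.
split; [exact: measurable_wrt_cst|exact: finite_measure_integrable_cst|].
move=> B /invariant_measurable mB; rewrite int1//.
have PCA : P (~` A) = 0%E by apply/negligibleP => //; exact: measurableC.
have mAB : measurable (A `&` B) by exact: measurableI.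
apply/eqP; rewrite eq_le; apply/andP; split; last first.
  by apply: le_measure; rewrite ?inE//; exact: subIsetr.
apply: (@le_trans _ _ (P ((A `&` B) `|` ~` A))).
  apply: le_measure; rewrite ?inE//.
    by apply: measurableU => //; exact: measurableC.
  by move=> w Bw; have [Aw|nAw] := pselect (A w); [left|right].
apply: (@le_trans _ _ (P (A `&` B) + P (~` A))%E); last by rewrite PCA adde0.
by apply: measureU2 => //; exact: measurableC.
Qed.

End orbit_space.

Section stationary_near_count.
Context {d : measure_display} {T : measurableType d} {R : realType}.
Variables (P : probability T R) (X : nat -> {RV P >-> R}).

(** This is [near_count_frequency] for the shift of the orbit space, started at
    time 0. An invariant function [q] on that space takes at [(w, i)] its
    value at [(w, 0)], and [w |-> q (w, 0)] is measurable with respect to the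
    invariant events: so the minimality of [gamma] carries over. *)
Lemma near_count_frequency_ae (a : R) (k : nat -> nat) (gamma : T -> \bar R)
    (p : T -> R) :
  strictly_stationary P X ->
  (forall n : nat, (1 <= n)%N -> (1 <= k n <= n)%N) ->
  (k n)%:R / n%:R @[n --> \oo] --> (1 : R) ->
  is_cond_right_endpoint P (invariant_sets X) (X 1%N) gamma ->
  is_cond_prob P (invariant_sets X)
    [set w | gamma w - a%:E < (X 1%N w)%:E]%E p ->
  P [set w | (X 1%N w)%:E = gamma w] = 0%E ->
  P [set w | (X 1%N w)%:E = (gamma w - a%:E)%E] = 0%E ->
  {ae P, forall w, (near_count (fun i => X i w) (k n) n a)%:R / n%:R
     @[n --> \oo] --> (gamma w < +oo)%E%:R * p w}.
Proof.
move=> hX hk hk1 [mg g1 gmin] [mp intp hp] hX0 hXa.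
pose mu := orbit_law X.
pose Y (wi : orbit_space X) : R := X wi.2.+1 wi.1.
have mY : measurable_fun setT Y.
  have -> : Y = (fun x : seq_space R => x 0%N) \o (orbit_map X : orbit_space X -> _).
    by apply/funext => wi; rewrite /Y /orbit_map /tail_seq /= addn0.
  apply: measurableT_comp; [exact: measurable_coord|exact: measurable_orbit_map].
have mgT : measurable_fun setT gamma.
  move=> _ B mB; rewrite setTI; apply: invariant_measurable; exact: mg.
have mX1 : measurable_fun setT (EFin \o X 1%N) by apply/measurable_EFinP.
pose G (wi : orbit_space X) := gamma wi.1.
have mG : measurable_fun setT G by exact: measurable_wrt_orbit.
have mYE : measurable_fun setT (EFin \o Y) by apply/measurable_EFinP.
have mle (q : orbit_space X -> \bar R) : measurable_fun setT q ->
    measurable [set x | ((Y x)%:E <= q x)%E].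
  by move=> mq; rewrite -[X in measurable X]setTI; exact: measurable_lee.
have aeg : {ae mu, forall x, ((Y x)%:E <= G x)%E}.
  apply: ae_orbit_law; first exact: mle.
  have mXg : measurable [set w | ((X 1%N w)%:E <= gamma w)%E].
    by rewrite -[X in measurable X]setTI; exact: measurable_lee.
  exact: (@cond_prob1P _ _ _ P X _ mXg).1 g1.
have gmin' (q : orbit_space X -> \bar R) : measurable_fun setT q ->
    q \o orbit_shift (X := X) = q -> {ae mu, forall x, ((Y x)%:E <= q x)%E} ->
    {ae mu, forall x, (G x <= q x)%E}.
  move=> mq qi Yq; apply: ae_orbit_law.
    by rewrite -[X in measurable X]setTI; exact: measurable_lee.
  apply: gmin; first exact: orbit_measurable_wrt.
  have mXq : measurable [set w | ((X 1%N w)%:E <= q (orbit_section X 0%N w))%E].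
    rewrite -[X in measurable X]setTI; apply: measurable_lee => //.
    exact: (measurableT_comp mq (@measurable_orbit_section _ _ _ _ X 0%N)).
  exact: (@cond_prob1P _ _ _ P X _ mXq).2 (ae_orbit_section Yq).
have mp' : measurable_fun setT (fun wi : orbit_space X => p wi.1).
  exact: measurable_wrt_orbit.
have mp'E : measurable_fun setT (fun wi : orbit_space X => (p wi.1)%:E).
  by apply/measurable_EFinP.
have intp' : mu.-integrable setT (fun wi : orbit_space X => (p wi.1)%:E).
  exact: integrable_pushforward.
have hp' A : measurable A -> orbit_shift (X := X) @^-1` A = A ->
    (\int[mu]_(x in A) (p x.1)%:E =
      mu ([set x | G x - a%:E < (Y x)%:E] `&` A))%E.
  move=> mA iA; have iA0 := invariant_orbit_section mA iA.
  transitivity (\int[P]_(w in orbit_section X 0%N @^-1` A) (p w)%:E)%E.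
    rewrite (integral_pushforward (@measurable_orbit_section _ _ _ _ X 0%N))//.
    by apply: integrableS intp => //; exact: (invariant_measurable iA0).
  by rewrite hp.
have := @near_count_frequency _ _ _ mu (@orbit_shift _ _ _ _ X)
  (@measurable_orbit_shift _ _ _ _ X) (orbit_law_shift hX) Y G mY mG erefl aeg gmin'
  hX0 a (fun wi => p wi.1) k mp' erefl intp' hp' hXa hk hk1.
move=> /ae_orbit_section; apply: filterS => w.
rewrite (_ : (fun n => _) = fun n =>
  (near_count (fun i => X i w) (k n) n a)%:R / n%:R)//.
apply/funext => n; congr (_%:R / _); apply: near_count_ext => j /=.
rewrite /Y.
have -> : iter j (orbit_shift (X := X)) (orbit_section X 0%N w) = (w, j).
  by elim: j => //= j ->.
by [].
Qed.

End stationary_near_count.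

(** * Measurability and elementary probability estimates *)

Section measurability_of_near_counts.
Context {d : measure_display} {T : measurableType d} {R : realType}.

Lemma measurable_random_index d' (U : measurableType d') (f : nat -> T -> U)
    (N : T -> nat) : (forall n, measurable_fun setT (f n)) ->
  measurable_fun setT N -> measurable_fun setT (fun w => f (N w) w).
Proof.
move=> mf mN _ B mB; rewrite setTI.
have -> : (fun w => f (N w) w) @^-1` B =
    \bigcup_n (N @^-1` [set n] `&` f n @^-1` B).
  by apply/seteqP; split=> [w Bw|w [n _ [/= <-]]//]; exists (N w).
apply: bigcupT_measurable => n; apply: measurableI.
- by rewrite -[_ @^-1` _]setTI; exact: mN.
- by rewrite -[_ @^-1` _]setTI; exact: mf.
Qed.

Lemma measurable_countr (b : nat -> T -> bool) n :
  (forall j, measurable_fun setT (b j)) ->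
  measurable_fun setT (fun w => (\sum_(0 <= j < n) b j w)%N%:R : R).
Proof.
move=> mb; have -> : (fun w => (\sum_(0 <= j < n) b j w)%N%:R : R) =
    (fun w => \sum_(0 <= j < n) (if b j w then 1 else 0)).
  by apply/funext => w; rewrite natr_sum; apply: eq_bigr => j _; case: (b j w).
by apply: measurable_sum => j; apply: measurable_fun_ifT => //; exact: measurable_cst.
Qed.

(** The order statistic is only accessible through counts, which are visibly
    measurable functions of the observations. *)
Lemma order_statE (x : nat -> R) k n (u : R) : (1 <= k <= n)%N ->
  (u < order_stat x k n) = (\sum_(0 <= j < n) (x j.+1 <= u)%R < k)%N.
Proof.
move=> kn; apply/idP/idP => [|h]; last first.
  by rewrite -lte_fin; exact: order_stat_gt.
apply: contraLR; rewrite -leqNgt -leNgt => h.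
apply: nth_count_le; first exact/sort_le_sorted.
case/andP: kn => k1 kn.
by rewrite count_sort count_map prednK// count_iota1.
Qed.

Variables (X : nat -> T -> R).
Hypothesis mX : forall n, measurable_fun setT (X n).

Lemma measurable_order_stat k n : (1 <= k <= n)%N ->
  measurable_fun setT (fun w => order_stat (X^~ w) k n).
Proof.
move=> kn; apply: (measurability _ (RGenOInfty.measurableE R)) => //.
move=> _ [_ [u ->] <-]; rewrite setTI.
have -> : (fun w => order_stat (X^~ w) k n) @^-1` `]u, +oo[ =
    (fun w => (\sum_(0 <= j < n) (X j.+1 w <= u)%R)%N%:R : R) @^-1` `]-oo, k%:R[.
  by apply/seteqP; split => w /=; rewrite !in_itv/= andbT order_statE// ltr_nat.
rewrite -[_ @^-1` _]setTI; apply: measurable_countr => //.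
by move=> j; apply: measurable_fun_ler => //; exact: measurable_cst.
Qed.

Lemma measurable_near_count (k n : nat) a : (1 <= k <= n)%N ->
  measurable_fun setT (fun w => (near_count (X^~ w) k n a)%:R : R).
Proof.
move=> kn; have mo := measurable_order_stat kn.
under eq_fun do rewrite near_countE.
apply: measurable_countr => j; apply: measurable_and.
  by apply: measurable_fun_ltr => //; exact: measurable_funB.
exact: measurable_fun_ltr.
Qed.

End measurability_of_near_counts.

Section probability_estimates.
Context {d : measure_display} {T : measurableType d} {R : realType}.
Variable P : probability T R.
Implicit Types (A B : set T).

Lemma cvge_finP I (F : set_system I) (FF : Filter F) (f : I -> \bar R) (l : R) :
  f x @[x --> F] --> l%:E <->
  forall e, 0 < e -> \forall x \near F, ((l - e)%:E <= f x <= (l + e)%:E)%E.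
Proof.
split=> [/fine_cvgP[ffin /cvgrPdist_le fl] e e0|h].
  apply: filterS2 ffin (fl e e0) => x fx /=.
  by rewrite -[f x in X in _ -> X]fineK// !lee_fin distrC ler_distl.
apply/fine_cvgP; split.
  have := h 1 ltr01; apply: filterS => x /andP[h1 h2].
  by rewrite fin_numElt (lt_le_trans _ h1) ?ltNyr// (le_lt_trans h2) ?ltry.
apply/cvgrPdist_le => e e0; apply: filterS (h e e0) => x /andP[h1 h2] /=.
have fx : f x \is a fin_num.
  by rewrite fin_numElt (lt_le_trans _ h1) ?ltNyr// (le_lt_trans h2) ?ltry.
by rewrite distrC ler_distl -!lee_fin fineK// h1 h2.
Qed.

Lemma cvg_measure0P I (F : set_system I) (FF : Filter F) (A : I -> set T) :
  P (A x) @[x --> F] --> 0%E <->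
  forall e, 0 < e -> \forall x \near F, (P (A x) <= e%:E)%E.
Proof.
rewrite cvge_finP; split=> h e e0; apply: filterS (h e e0) => x.
  by move=> /andP[_]; rewrite add0r.
move=> Ax; rewrite sub0r add0r Ax andbT (@le_trans _ _ 0%E)// ?measure_ge0//.
by rewrite lee_fin oppr_le0 ltW.
Qed.

Lemma le_measure_ae A B : measurable A -> measurable B ->
  {ae P, forall w, A w -> B w} -> (P A <= P B)%E.
Proof.
move=> mA mB [C [mC PC0 hC]].
apply: (@le_trans _ _ (P (B `|` C))).
  apply: le_measure; rewrite ?inE//; first exact: measurableU.
  move=> w Aw; have [Bw|nBw] := pselect (B w); [by left|right].
  by apply: hC => /= AB; apply: nBw; exact: AB.
apply: (@le_trans _ _ (P B + P C)%E); first exact: measureU2.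
by rewrite PC0 adde0.
Qed.

Lemma measure_cover2 A B C (r s : R) : measurable A -> measurable B -> measurable C ->
  {ae P, forall w, A w -> B w \/ C w} ->
  (P B <= r%:E)%E -> (P C <= s%:E)%E -> (P A <= (r + s)%:E)%E.
Proof.
move=> mA mB mC h PB PC.
apply: (@le_trans _ _ (P (B `|` C))).
  by apply: le_measure_ae => //; exact: measurableU.
apply: (@le_trans _ _ (P B + P C)%E); first exact: measureU2.
by rewrite EFinD leeD.
Qed.

Lemma measurable_ge_dist (e : R) (f h : T -> R) : measurable_fun setT f ->
  measurable_fun setT h -> measurable [set w | e <= `|f w - h w|].
Proof.
move=> mf mh.
have -> : [set w | e <= `|f w - h w|] = (fun w => `|f w - h w|) @^-1` `[e, +oo[.
  by apply/seteqP; split=> w /=; rewrite in_itv/= andbT.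
rewrite -[_ @^-1` _]setTI.
suff : measurable_fun setT (fun w => `|f w - h w|) by apply => //; exact: measurable_itv.
by apply: measurableT_comp => //; exact: measurable_funB.
Qed.

Lemma measurable_le_cst (f : T -> R) x : measurable_fun setT f ->
  measurable (f @^-1` `]-oo, x]).
Proof.
by move=> mf; rewrite -[_ @^-1` _]setTI; apply: mf => //; exact: measurable_itv.
Qed.

End probability_estimates.

(** * Random numbers of observations: almost sure limits and limits in probability *)

Section random_index.
Context {d : measure_display} {T : measurableType d} {R : realType}.
Variables (P : probability T R) (W : nat -> T -> R) (L : T -> R).
Variables (N : R -> T -> nat) (c : R -> R).
Hypothesis W_cvg : {ae P, forall w, W n w @[n --> \oo] --> L w}.
Hypothesis c_gt0 : forall t, 0 <= t -> 0 < c t.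
Hypothesis c_cvgy : c t @[t --> +oo] --> +oo.

Let Nc t w := (N t w)%:R / c t.
Let Kc t w := Nc t w * W (N t w) w.

Let near_c_gt0 : \forall t \near +oo, 0 < c t.
Proof.
by near=> t; apply: c_gt0; near: t; exact: nbhs_pinfty_ge.
Unshelve. all: by end_near. Qed.

Lemma cvg_as_random_index (Z : T -> R) : {ae P, forall w, 0 < Z w} ->
  cvg_as P Nc Z -> cvg_as P Kc (fun w => Z w * L w).
Proof.
move=> Z0 NZ; apply: filterS3 Z0 NZ W_cvg => w Zw Nw Ww.
apply: cvgM => //.
suff : N t w @[t --> +oo] --> \oo by move=> Noo; exact: (cvg_comp _ _ Noo Ww).
apply/cvgnyPge => m; near=> t.
have ct : 0 < c t by near: t; exact: near_c_gt0.
have cm : m%:R / (Z w / 2) <= c t.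
  by near: t; move/cvgryPge : c_cvgy; apply.
have NZt : Z w / 2 < Nc t w.
  near: t; move/cvgrPdist_lt : Nw => /(_ (Z w / 2)).
  rewrite divr_gt0// => /(_ isT); apply: filterS => t.
  by rewrite ltr_distl => /andP[_]; rewrite /Nc; lra.
rewrite -(ler_nat R); move: cm; rewrite ler_pdivrMr ?divr_gt0// => /le_trans; apply.
by move: NZt; rewrite /Nc ltr_pdivlMr// mulrC => /ltW.
Unshelve. all: by end_near. Qed.

Hypothesis mW : forall n, measurable_fun setT (W n).
Hypothesis mL : measurable_fun setT L.
Hypothesis W01 : forall n w, 0 <= W n w <= 1.
Hypothesis mN : forall t, 0 <= t -> measurable_fun setT (N t).

Let near_mN : \forall t \near +oo, measurable_fun setT (N t).
Proof.
by near=> t; apply: mN; near: t; exact: nbhs_pinfty_ge.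
Unshelve. all: by end_near. Qed.

Lemma measurable_Nc t : measurable_fun setT (N t) -> measurable_fun setT (Nc t).
Proof.
move=> mNt; apply: measurable_funM; last exact: measurable_cst.
by apply: (measurableT_comp _ mNt).
Qed.

Lemma measurable_WN t : measurable_fun setT (N t) ->
  measurable_fun setT (fun w => W (N t w) w).
Proof. exact: measurable_random_index. Qed.

Lemma measurable_Kc t : measurable_fun setT (N t) -> measurable_fun setT (Kc t).
Proof.
by move=> mNt; apply: measurable_funM; [exact: measurable_Nc|exact: measurable_WN].
Qed.

Let measurable_Nlt t m : measurable_fun setT (N t) -> measurable [set w | (N t w < m)%N].
Proof.
by move=> mNt; rewrite -[X in measurable X]setTI; apply: (mNt _ [set n | (n < m)%N]).
Qed.

Lemma uniform_tail_prob (e eta : R) : 0 < e -> 0 < eta -> exists m,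
  (P (\bigcup_(n in [set n | (m <= n)%N]) [set w | (e <= `|W n w - L w|)%R]) <= eta%:E)%E.
Proof.
move=> e0 eta0.
pose D m := \bigcup_(n in [set n | (m <= n)%N]) [set w | e <= `|W n w - L w|].
have mD m : measurable (D m).
  by apply: bigcup_measurable => n _; exact: measurable_ge_dist.
have mDD : measurable (\bigcap_m D m) by exact: bigcapT_measurable.
have PD0 : P (\bigcap_m D m) = 0%E.
  apply/negligibleP => //.
  have [C [mC PC0 hC]] := W_cvg; exists C; split => // w Dw; apply: hC => /= Ww.
  move/cvgrPdist_lt : Ww => /(_ e e0)[m _ hm].
  have [n /= mn] := Dw m I; have := hm n mn; rewrite /= distrC => /lt_le_trans h /h.
  by rewrite ltxx.
have : P (D m) @[m --> \oo] --> 0%E.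
  rewrite -PD0; apply: nonincreasing_cvg_mu => //.
    by apply: le_lt_trans (probability_le1 P (mD 0%N)) _; rewrite ltry.
  apply/nonincreasing_seqP => m; apply/subsetPset => w [n /= mn hn].
  by exists n => //=; exact: ltnW.
move/cvg_measure0P => /(_ eta eta0)[m _ hm]; exists m; exact: hm (leqnn m).
Qed.

(** The random index may depend on [W] in any way, but once it is at least
    [m], the deviation of [W] is controlled uniformly over all indices above
    [m]. *)
Lemma random_index_prob :
  (forall m (e : R), 0 < e ->
     \forall t \near +oo, (P [set w | (N t w < m)%N] <= e%:E)%E) ->
  forall e eta : R, 0 < e -> 0 < eta -> \forall t \near +oo,
    (P [set w | (e <= `|W (N t w) w - L w|)%R] <= eta%:E)%E.
Proof.
move=> Noo e eta e0 eta0; have eta20 : 0 < eta / 2 by rewrite divr_gt0.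
have [m hm] := uniform_tail_prob e0 eta20.
near=> t; have mNt : measurable_fun setT (N t) by near: t; exact: near_mN.
rewrite [eta]splitr; apply: measure_cover2 hm.
- by apply: measurable_ge_dist => //; exact: measurable_WN.
- exact: (measurable_Nlt m mNt).
- by apply: bigcup_measurable => n _; exact: measurable_ge_dist.
- apply: aeW => w /= h; have [nm|mn] := ltnP (N t w) m; [by left|right].
  by exists (N t w).
- by near: t; exact: Noo.
Unshelve. all: by end_near. Qed.

(** As [c t] tends to infinity, [N t < m] forces the normalized index below
    any fixed [s > 0]. *)
Lemma index_diverges_prob :
  (forall e : R, 0 < e -> exists2 s : R, 0 < s &
     \forall t \near +oo, (P (Nc t @^-1` `]-oo, s]) <= e%:E)%E) ->
  forall m (e : R), 0 < e ->
    \forall t \near +oo, (P [set w | (N t w < m)%N] <= e%:E)%E.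
Proof.
move=> h m e e0; have [s s0 hs] := h e e0.
near=> t; have mNt : measurable_fun setT (N t) by near: t; exact: near_mN.
have ct : 0 < c t by near: t; exact: near_c_gt0.
have cm : m%:R / s <= c t by near: t; move/cvgryPge : c_cvgy; apply.
apply: (@le_trans _ _ (P (Nc t @^-1` `]-oo, s]))); last by near: t.
apply: le_measure; rewrite ?inE//.
- exact: (measurable_Nlt m mNt).
- by apply: measurable_le_cst; exact: measurable_Nc.
move=> w /= Nm; rewrite in_itv/= /Nc ler_pdivrMr//.
rewrite ler_pdivrMr// mulrC in cm; apply: le_trans cm.
by rewrite ler_nat ltnW.
Unshelve. all: by end_near. Qed.

Lemma small_value_prob (Z : T -> R) (e : R) : measurable_fun setT Z ->
  {ae P, forall w, 0 < Z w} -> 0 < e ->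
  exists2 s : R, 0 < s & (P (Z @^-1` `]-oo, s]) <= e%:E)%E.
Proof.
move=> mZ Z0 e0.
pose D m := Z @^-1` `]-oo, m.+1%:R^-1].
have mD m : measurable (D m) by exact: measurable_le_cst.
have mDD : measurable (\bigcap_m D m) by exact: bigcapT_measurable.
have PD0 : P (\bigcap_m D m) = 0%E.
  apply/negligibleP => //.
  have [C [mC PC0 hC]] := Z0; exists C; split => // w Dw; apply: hC => /= Zw.
  have [m] := ex_natSinv_lt Zw; rewrite ltNge => /negP; apply.
  by have := Dw m I; rewrite /D/= in_itv.
have : P (D m) @[m --> \oo] --> 0%E.
  rewrite -PD0; apply: nonincreasing_cvg_mu => //.
    by apply: le_lt_trans (probability_le1 P (mD 0%N)) _; rewrite ltry.
  apply/nonincreasing_seqP => m; apply/subsetPset => w.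
  rewrite /D/= !in_itv/= => /le_trans; apply.
  by rewrite lef_pV2 ?posrE// ler_nat.
move/cvg_measure0P => /(_ e e0)[m _ hm]; exists m.+1%:R^-1; last exact: hm (leqnn m).
by rewrite invr_gt0.
Qed.

Lemma large_value_prob (Z : T -> R) (e : R) : measurable_fun setT Z -> 0 < e ->
  exists2 s : R, 0 < s & (P (Z @^-1` `]s, +oo[) <= e%:E)%E.
Proof.
move=> mZ e0.
pose D m := Z @^-1` `]m.+1%:R, +oo[.
have mD m : measurable (D m).
  by rewrite -[D m]setTI; apply: mZ => //; exact: measurable_itv.
have mDD : measurable (\bigcap_m D m) by exact: bigcapT_measurable.
have PD0 : P (\bigcap_m D m) = 0%E.
  rewrite (_ : \bigcap_m D m = set0) ?measure0//; apply/seteqP; split => // w Dw.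
  have := Dw (Num.bound `|Z w|) I; rewrite /D/= in_itv/= andbT => /ltW.
  rewrite leNgt => /negP; apply.
  apply: le_lt_trans (ler_norm _) _; apply: lt_le_trans (archi_boundP _) _ => //.
  by rewrite ler_nat.
have : P (D m) @[m --> \oo] --> 0%E.
  rewrite -PD0; apply: nonincreasing_cvg_mu => //.
    by apply: le_lt_trans (probability_le1 P (mD 0%N)) _; rewrite ltry.
  apply/nonincreasing_seqP => m; apply/subsetPset => w.
  rewrite /D/= !in_itv/= !andbT; apply: le_lt_trans.
  by rewrite ler_nat.
move/cvg_measure0P => /(_ e e0)[m _ hm]; exists m.+1%:R; last exact: hm (leqnn m).
by rewrite ltr0n.
Qed.

(** Follows from [Nc W - Z L = (Nc - Z) W + (W - L) Z] with [0 <= W <= 1],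
    truncating [Z] at a level [s] that it rarely exceeds. *)
Lemma cvg_prob_random_index (Z : T -> R) : measurable_fun setT Z ->
  {ae P, forall w, 0 < Z w} ->
  cvg_prob P Nc Z -> cvg_prob P Kc (fun w => Z w * L w).
Proof.
move=> mZ Z0 NZ.
have {}NZ e eta : 0 < e -> 0 < eta ->
    \forall t \near +oo, (P [set w | (e <= `|Nc t w - Z w|)%R] <= eta%:E)%E.
  by move=> e0; have /cvg_measure0P := NZ e e0; apply.
have Noo : forall m (e : R), 0 < e ->
    \forall t \near +oo, (P [set w | (N t w < m)%N] <= e%:E)%E.
  apply: index_diverges_prob => e e0; have e20 : 0 < e / 2 by rewrite divr_gt0.
  have [s s0 hs] := small_value_prob mZ Z0 e20.
  have s20 : 0 < s / 2 by rewrite divr_gt0.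
  exists (s / 2) => //; near=> t.
  have mNt : measurable_fun setT (N t) by near: t; exact: near_mN.
  have mNct := measurable_Nc mNt.
  rewrite [e]splitr; apply: (measure_cover2 _ _ _ _ _ hs).
  - exact: measurable_le_cst.
  - exact: (measurable_ge_dist (s / 2) mNct mZ).
  - exact: measurable_le_cst.
  - apply: aeW => w /=; rewrite !in_itv/= => Ns.
    have [Zs|Zs] := leP (Z w) s; [by right|left].
    by rewrite distrC (le_trans _ (ler_norm _))//; lra.
  - by near: t; exact: NZ.
move=> e e0; apply/cvg_measure0P => eta eta0.
have eta20 : 0 < eta / 2 by rewrite divr_gt0.
have eta40 : 0 < eta / 2 / 2 by rewrite divr_gt0.
have e20 : 0 < e / 2 by rewrite divr_gt0.
(* [s] bounds the factor [Z] of [W - L] outside an event of small probability,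
   so that [W - L] has to be compared with [e / 2 / s]. *)
have [s s0 hs] := large_value_prob mZ eta40.
have es0 : 0 < e / 2 / s by rewrite divr_gt0.
near=> t.
have mNt : measurable_fun setT (N t) by near: t; exact: near_mN.
have mNct := measurable_Nc mNt; have mWNt := measurable_WN mNt.
have mZs : measurable (Z @^-1` `]s, +oo[).
  by rewrite -[_ @^-1` _]setTI; apply: mZ => //; exact: measurable_itv.
have m1 := measurable_ge_dist (e / 2) mNct mZ.
have m2 := measurable_ge_dist (e / 2 / s) mWNt mL.
rewrite [eta]splitr.
apply: (@measure_cover2 _ _ _ _ _ _ (Z @^-1` `]s, +oo[ `|`
  [set w | e / 2 / s <= `|W (N t w) w - L w|]) _ _ _ m1).
- apply: measurable_ge_dist; first exact: measurable_Kc.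
  exact: measurable_funM.
- exact: measurableU.
- apply: filterS Z0 => w Zw /= he.
  have [h1|h1] := leP (e / 2) `|Nc t w - Z w|; first by left.
  right; have [Zs|Zs] := ltP s (Z w); first by left; rewrite /= in_itv/= Zs.
  right => /=; rewrite ler_pdivrMr//.
  have W1 := W01 (N t w) w.
  have : `|Kc t w - Z w * L w| <= `|Nc t w - Z w| + `|W (N t w) w - L w| * s.
    have -> : Kc t w - Z w * L w =
        (Nc t w - Z w) * W (N t w) w + (W (N t w) w - L w) * Z w.
      by rewrite /Kc; ring.
    apply: le_trans (ler_normD _ _) _; rewrite !normrM; apply: lerD.
      by rewrite ler_piMr// ger0_norm; case/andP: W1.
    by rewrite ler_wpM2l// gtr0_norm.
  lra.
- by near: t; exact: NZ.
- rewrite [eta / 2]splitr; apply: (measure_cover2 _ mZs m2 _ hs).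
  + exact: measurableU.
  + exact: aeW.
  + by near: t; exact: random_index_prob.
Unshelve. all: by end_near. Qed.

End random_index.

(** * Random numbers of observations: limits in distribution *)

Section convergence_in_distribution.
Context {d : measure_display} {T : measurableType d} {R : realType}.
Variable P : probability T R.

Let cdfr (Z : T -> R) x : R := fine (P (Z @^-1` `]-oo, x])).

Lemma probability_leK (Z : T -> R) x : measurable_fun setT Z ->
  P (Z @^-1` `]-oo, x]) = (fine (P (Z @^-1` `]-oo, x])))%:E.
Proof. by move=> mZ; rewrite fineK// fin_num_measure//; exact: measurable_le_cst. Qed.

Lemma probability_le_nondecreasing (Z : T -> R) x y : measurable_fun setT Z -> x <= y ->
  (P (Z @^-1` `]-oo, x]) <= P (Z @^-1` `]-oo, y]))%E.
Proof.
move=> mZ xy; apply: le_measure; rewrite ?inE; [exact: measurable_le_cst..|].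
by move=> w /=; rewrite !in_itv/= => /le_trans; apply.
Qed.

Lemma probability_le_continuous (Z : T -> R) x : measurable_fun setT Z ->
  P (Z @^-1` [set x]) = 0%E ->
  {for x, continuous (fun y => P (Z @^-1` `]-oo, y]))}.
Proof.
move=> mZ Zx0.
have right : forall e, 0 < e -> exists n,
    (P (Z @^-1` `]-oo, (x + n.+1%:R^-1)%R]) <= (cdfr Z x + e)%:E)%E.
  move=> e e0; pose D n := Z @^-1` `]-oo, (x + n.+1%:R^-1)].
  have mD n : measurable (D n) by exact: measurable_le_cst.
  have DE : \bigcap_n D n = Z @^-1` `]-oo, x].
    apply/seteqP; split=> [w Dw|w]; rewrite /= in_itv/=; last first.
      by move=> Zw n _; rewrite /D/= in_itv/= (le_trans Zw)// lerDl invr_ge0.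
    rewrite leNgt; apply/negP => xZ.
    have [n] := ex_natSinv_lt (etrans (subr_gt0 _ _) xZ).
    have := Dw n I; rewrite /D/= in_itv/=; set v := _^-1; lra.
  have : P (D n) @[n --> \oo] --> (cdfr Z x)%:E.
    rewrite -probability_leK// -DE; apply: nonincreasing_cvg_mu => //.
    - by apply: le_lt_trans (probability_le1 P (mD 0%N)) _; rewrite ltry.
    - exact: bigcapT_measurable.
    - apply/nonincreasing_seqP => n; apply/subsetPset => w.
      rewrite /D/= !in_itv/= => /le_trans; apply.
      by rewrite lerD2l lef_pV2 ?posrE// ler_nat.
  by move/cvge_finP => /(_ e e0)[n _ hn]; exists n; have /andP[] := hn n (leqnn n).
have left : forall e, 0 < e -> exists n,
    ((cdfr Z x - e)%:E <= P (Z @^-1` `]-oo, (x - n.+1%:R^-1)%R]))%E.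
  move=> e e0; pose D n := Z @^-1` `]-oo, (x - n.+1%:R^-1)].
  have mD n : measurable (D n) by exact: measurable_le_cst.
  have mx : measurable (Z @^-1` [set x]) by rewrite -[_ @^-1` _]setTI; exact: mZ.
  have mDD : measurable (\bigcup_n D n) by exact: bigcupT_measurable.
  have DE : P (\bigcup_n D n) = P (Z @^-1` `]-oo, x]).
    apply/eqP; rewrite eq_le; apply/andP; split.
      apply: le_measure; rewrite ?inE//; first exact: measurable_le_cst.
      move=> w [n _]; rewrite /D/= !in_itv/= => /le_trans; apply.
      by rewrite lerBlDr lerDl invr_ge0.
    apply: le_measure_ae => //; first exact: measurable_le_cst.
    exists (Z @^-1` [set x]); split => // w /= /not_implyP[].
    rewrite in_itv/= le_eqVlt => /orP[/eqP//|xZ] []; move: xZ => xZ.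
    have [n nx] := ex_natSinv_lt (etrans (subr_gt0 _ _) xZ).
    by exists n => //; rewrite /D/= in_itv/= lerBrDr -lerBrDl ltW.
  have : P (D n) @[n --> \oo] --> (cdfr Z x)%:E.
    rewrite -probability_leK// -DE; apply: nondecreasing_cvg_mu => //.
    apply/nondecreasing_seqP => n; apply/subsetPset => w.
    rewrite /D/= !in_itv/= => /le_trans; apply.
    by rewrite lerD2l lerN2 lef_pV2 ?posrE// ler_nat.
  by move/cvge_finP => /(_ e e0)[n _ hn]; exists n; have /andP[] := hn n (leqnn n).
rewrite /prop_for /continuous_at probability_leK//; apply/cvge_finP => e e0.
have [n hn] := right e e0; have [m hm] := left e e0.
near=> y; apply/andP; split.
  apply: (le_trans hm); apply: probability_le_nondecreasing => //.
  by apply: ltW; near: y; apply: lt_nbhsr; rewrite ltrBlDr ltrDl invr_gt0.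
apply: le_trans hn; apply: probability_le_nondecreasing => //.
by apply: ltW; near: y; apply: lt_nbhsl; rewrite ltrDl invr_gt0.
Unshelve. all: by end_near. Qed.

(** A random variable has at most countably many atoms, so an interval cannot
    consist of atoms only. *)
Lemma continuity_point_between (Z : T -> R) x y : measurable_fun setT Z -> x < y ->
  exists s, [/\ x < s, s < y & {for s, continuous (fun y => P (Z @^-1` `]-oo, y]))}].
Proof.
move=> mZ xy; apply: contrapT => /forallNP h.
pose Zm : {mfun T >-> R} := HB.pack Z (isMeasurableFun.Build _ _ _ _ Z mZ).
have : countable `]x, y[%classic.
  apply: sub_countable (pmf_gt0_countable (Zm : {RV P >-> R})).
  apply: subset_card_le => s /=; rewrite in_itv/= => /andP[xs sy].
  rewrite lt_neqAle pmf_ge0 andbT; apply/eqP => Zs0; apply: (h s); split => //.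
  apply: probability_le_continuous => //; rewrite -[LHS]fineK//.
    by congr (_%:E); exact: esym Zs0.
  by rewrite fin_num_measure// -[_ @^-1` _]setTI; exact: (measurable_funP Zm).
move/countable_lebesgue_measure0; rewrite lebesgue_measure_itv/= lte_fin xy.
by rewrite -EFinB => -[] /eqP; rewrite subr_eq0 gt_eqF.
Qed.

End convergence_in_distribution.

Section slutsky.
Context {d : measure_display} {T : measurableType d} {R : realType}.
Context {d' : measure_display} {T' : measurableType d'}.
Variables (P : probability T R) (P' : probability T' R).

Lemma cvg_distr_near (V : R -> T -> R) (Z : T' -> R) x (e : R) :
  measurable_fun setT Z -> cvg_distr P P' V Z ->
  {for x, continuous (fun y => P' (Z @^-1` `]-oo, y]))} -> 0 < e ->
  \forall t \near +oo,
    ((fine (P' (Z @^-1` `]-oo, x])) - e)%:E <= P (V t @^-1` `]-oo, x])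
      <= (fine (P' (Z @^-1` `]-oo, x])) + e)%:E)%E.
Proof.
move=> mZ VZ cx e0; have := VZ x cx; rewrite probability_leK//.
by move/cvge_finP; exact.
Qed.

Lemma cvg_distr_near_ge (V : R -> T -> R) (Z : T' -> R) x (e : R) :
  measurable_fun setT Z -> cvg_distr P P' V Z ->
  {for x, continuous (fun y => P' (Z @^-1` `]-oo, y]))} -> 0 < e ->
  \forall t \near +oo,
    ((fine (P' (Z @^-1` `]-oo, x])) - e)%:E <= P (V t @^-1` `]-oo, x]))%E.
Proof.
by move=> mZ VZ cx e0; apply: filterS (cvg_distr_near mZ VZ cx e0) => t /andP[].
Qed.

Lemma cvg_distr_near_le (V : R -> T -> R) (Z : T' -> R) x (e : R) :
  measurable_fun setT Z -> cvg_distr P P' V Z ->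
  {for x, continuous (fun y => P' (Z @^-1` `]-oo, y]))} -> 0 < e ->
  \forall t \near +oo,
    (P (V t @^-1` `]-oo, x]) <= (fine (P' (Z @^-1` `]-oo, x])) + e)%:E)%E.
Proof.
by move=> mZ VZ cx e0; apply: filterS (cvg_distr_near mZ VZ cx e0) => t /andP[].
Qed.

(** The distribution function of [V' t] at [x] is squeezed between those of
    [V t] at continuity points of the limit on either side of [x]. *)
Lemma slutsky (V V' : R -> T -> R) (Z : T' -> R) :
  measurable_fun setT Z ->
  (\forall t \near +oo, measurable_fun setT (V t)) ->
  (\forall t \near +oo, measurable_fun setT (V' t)) ->
  (forall e eta : R, 0 < e -> 0 < eta -> \forall t \near +oo,
     (P [set w | (e <= `|V' t w - V t w|)%R] <= eta%:E)%E) ->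
  cvg_distr P P' V Z -> cvg_distr P P' V' Z.
Proof.
move=> mZ mV mV' VV' VZ F x cx.
rewrite {}/F in cx *; rewrite probability_leK//; apply/cvge_finP => e e0.
set r := fine _.
have e40 : 0 < e / 4 by rewrite divr_gt0.
have : \forall y \near x, ((r - e / 4)%:E <= P' (Z @^-1` `]-oo, y]) <= (r + e / 4)%:E)%E.
  by move: cx; rewrite /prop_for /continuous_at probability_leK// => /cvge_finP; exact.
move=> /nbhs_ballP[del /= del0 hdel].
have xdel : x < x + del by rewrite ltrDl.
have delx : x - del < x by rewrite ltrBlDr ltrDl.
have [s [xs sdel cs]] := continuity_point_between P' mZ xdel.
have [s' [dels' s'x cs']] := continuity_point_between P' mZ delx.
have Fs : fine (P' (Z @^-1` `]-oo, s])) <= r + e / 4.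
  have /hdel : ball x del s by rewrite /ball/= distrC gtr0_norm ?subr_gt0//; lra.
  by move=> /andP[_]; rewrite probability_leK// lee_fin.
have Fs' : r - e / 4 <= fine (P' (Z @^-1` `]-oo, s'])).
  have /hdel : ball x del s' by rewrite /ball/= gtr0_norm ?subr_gt0//; lra.
  by move=> /andP[+ _]; rewrite [X in (_ <= X)%E]probability_leK// lee_fin.
have sx0 : 0 < s - x by rewrite subr_gt0.
have xs'0 : 0 < x - s' by rewrite subr_gt0.
near=> t.
have mVt : measurable_fun setT (V t) by near: t.
have mVt' : measurable_fun setT (V' t) by near: t.
have mVV' z : measurable [set w | z <= `|V' t w - V t w|] by exact: measurable_ge_dist.
have mVx z := measurable_le_cst z mVt.
have mVx' z := measurable_le_cst z mVt'.
apply/andP; split.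
  have h1 : ((fine (P' (Z @^-1` `]-oo, s'])) - e / 4)%:E <= P (V t @^-1` `]-oo, s']))%E.
    by near: t; exact: cvg_distr_near_ge.
  have h2 : (P [set w | (x - s' <= `|V' t w - V t w|)%R] <= (e / 4)%:E)%E.
    by near: t; exact: VV'.
  have PV' := probability_leK P x mVt'; rewrite PV'.
  have PV'le : (P (V' t @^-1` `]-oo, x]) <= (fine (P (V' t @^-1` `]-oo, x])))%:E)%E.
    by rewrite -PV'.
  have h3 : (P (V t @^-1` `]-oo, s']) <=
      (fine (P (V' t @^-1` `]-oo, x])) + e / 4)%:E)%E.
    apply: (measure_cover2 (mVx s') (mVx' x) (mVV' (x - s'))) => //.
    apply: aeW => w /=; rewrite !in_itv/= => Vs.
    have [Vx|Vx] := leP (V' t w) x; [by left|right].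
    by rewrite (le_trans _ (ler_norm _))//; lra.
  by have := le_trans h1 h3; rewrite !lee_fin; lra.
have h1 : (P (V t @^-1` `]-oo, s]) <= (fine (P' (Z @^-1` `]-oo, s])) + e / 4)%:E)%E.
  by near: t; exact: cvg_distr_near_le.
have h2 : (P [set w | (s - x <= `|V' t w - V t w|)%R] <= (e / 4)%:E)%E.
  by near: t; exact: VV'.
have h3 : (P (V' t @^-1` `]-oo, x]) <=
    (fine (P' (Z @^-1` `]-oo, s])) + e / 4 + e / 4)%:E)%E.
  apply: (measure_cover2 (mVx' x) (mVx s) (mVV' (s - x))) => //.
  apply: aeW => w /=; rewrite !in_itv/= => Vs.
  have [Vx|Vx] := leP (V t w) s; [by left|right].
  by rewrite distrC (le_trans _ (ler_norm _))//; lra.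
by apply: (le_trans h3); rewrite lee_fin; lra.
Unshelve. all: by end_near. Qed.

(** For [l = 0] both sides are point masses at 0, and convergence holds at
    every [x]. *)
Lemma cvg_distr_scale (V : R -> T -> R) (Z : T' -> R) (l : R) : 0 <= l ->
  cvg_distr P P' V Z ->
  cvg_distr P P' (fun t w => V t w * l) (fun w => Z w * l).
Proof.
rewrite le_eqVlt => /predU1P[<- _ F x _|l0 VZ F x]; rewrite {}/F.
  have [x0|x0] := leP 0 x.
    have E U (f : U -> R) : (fun w => f w * 0) @^-1` `]-oo, x] = setT.
      by apply/seteqP; split => // w _ /=; rewrite in_itv/= mulr0.
    rewrite E; under eq_fun do rewrite E.
    by rewrite !probability_setT; exact: cvg_cst.
  have E U (f : U -> R) : (fun w => f w * 0) @^-1` `]-oo, x] = set0.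
    by apply/seteqP; split => // w /=; rewrite in_itv/= mulr0 leNgt x0.
  rewrite E; under eq_fun do rewrite E.
  by rewrite !measure0; exact: cvg_cst.
have E U (f : U -> R) y : (fun w => f w * l) @^-1` `]-oo, y] = f @^-1` `]-oo, y / l].
  by apply/seteqP; split => w /=; rewrite !in_itv/= ler_pdivlMr.
move=> cx; rewrite E; under eq_fun do rewrite E; apply: VZ.
move: cx; rewrite (_ : (fun y => _) = (fun y => P' (Z @^-1` `]-oo, y / l]))); last first.
  by apply/funext => y; rewrite E.
move=> cx.
have -> : (fun y => P' (Z @^-1` `]-oo, y])) =
    (fun y => P' (Z @^-1` `]-oo, y / l])) \o (fun y => y * l).
  by apply/funext => y /=; rewrite mulfK// gt_eqF.
apply: continuous_comp; first exact: mulrr_continuous.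
by rewrite mulfVK ?gt_eqF.
Qed.

Lemma cvg_distr_cst (V : R -> T -> R) (Z : T' -> R) (z : R) :
  measurable_fun setT Z ->
  (\forall t \near +oo, measurable_fun setT (V t)) ->
  {ae P', forall w, Z w = z} -> cvg_distr P P' V Z -> cvg_prob P V (cst z).
Proof.
move=> mZ mV Zz VZ e e0; apply/cvg_measure0P => eta eta0.
have eta20 : 0 < eta / 2 by rewrite divr_gt0.
have ze : z < z + e by rewrite ltrDl.
have ez : z - e < z by rewrite ltrBlDr ltrDl.
have [s [zs se cs]] := continuity_point_between P' mZ ze.
have [s' [es' s'z cs']] := continuity_point_between P' mZ ez.
have Fs : fine (P' (Z @^-1` `]-oo, s])) = 1.
  rewrite (_ : P' _ = 1%E)//; apply/eqP; rewrite eq_le.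
  rewrite probability_le1/=; last exact: measurable_le_cst.
  rewrite -(@probability_setT _ _ _ P'); apply: le_measure_ae => //.
    exact: measurable_le_cst.
  by apply: filterS Zz => w Zw _; rewrite /= in_itv/= Zw ltW.
have Fs' : fine (P' (Z @^-1` `]-oo, s'])) = 0.
  rewrite (_ : P' _ = 0%E)//; apply/eqP; rewrite eq_le measure_ge0 andbT.
  rewrite -(@measure0 _ _ _ P'); apply: le_measure_ae => //.
    exact: measurable_le_cst.
  by apply: filterS Zz => w Zw; rewrite /= in_itv/= Zw leNgt s'z.
near=> t.
have mVt : measurable_fun setT (V t) by near: t.
have mVx z := measurable_le_cst z mVt.
have h1 : ((fine (P' (Z @^-1` `]-oo, s])) - eta / 2)%:E <= P (V t @^-1` `]-oo, s]))%E.
  by near: t; exact: cvg_distr_near_ge.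
have h2 : (P (V t @^-1` `]-oo, s']) <= (fine (P' (Z @^-1` `]-oo, s'])) + eta / 2)%:E)%E.
  by near: t; exact: cvg_distr_near_le.
rewrite Fs in h1; rewrite Fs' add0r in h2.
rewrite [eta]splitr; apply: (measure_cover2 _ (measurableC (mVx s)) (mVx s')) => //.
- by apply: measurable_ge_dist => //; exact: measurable_cst.
- apply: aeW => w /=; rewrite !in_itv/= => he.
  have [Vs'|Vs'] := leP (V t w) s'; [by right|left].
  apply/negP; rewrite -ltNge; move: he; rewrite /cst ler_normr => /orP[]; lra.
- rewrite probability_setC// probability_leK//; move: h1.
  rewrite probability_leK// -EFinB !lee_fin; lra.
Unshelve. all: by end_near. Qed.

End slutsky.

Section random_index_distribution.
Context {d : measure_display} {T : measurableType d} {R : realType}.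
Context {d' : measure_display} {T' : measurableType d'}.
Variables (P : probability T R) (P' : probability T' R).
Variables (W : nat -> T -> R) (l : R) (N : R -> T -> nat) (c : R -> R).
Hypothesis W_cvg : {ae P, forall w, W n w @[n --> \oo] --> l}.
Hypothesis c_gt0 : forall t, 0 <= t -> 0 < c t.
Hypothesis c_cvgy : c t @[t --> +oo] --> +oo.
Hypothesis mW : forall n, measurable_fun setT (W n).
Hypothesis W01 : forall n w, 0 <= W n w <= 1.
Hypothesis mN : forall t, 0 <= t -> measurable_fun setT (N t).

Let Nc t w := (N t w)%:R / c t.
Let Kc t w := Nc t w * W (N t w) w.

(** [Nc * l] converges in distribution to [Z * l] by scaling, and differs from
    [Nc * W] by [Nc * (W - l)], which tends to 0 in probability because [Nc] is
    tight. *)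
Lemma cvg_distr_random_index (Z : T' -> R) : measurable_fun setT Z ->
  {ae P', forall w, 0 < Z w} -> cvg_distr P P' Nc Z ->
  cvg_distr P P' Kc (fun w => Z w * l).
Proof.
move=> mZ Z0 NZ.
have near_c_gt0 : \forall t \near +oo, 0 < c t.
  by near=> t; apply: c_gt0; near: t; exact: nbhs_pinfty_ge.
have near_mN : \forall t \near +oo, measurable_fun setT (N t).
  by near=> t; apply: mN; near: t; exact: nbhs_pinfty_ge.
have near_mNc : \forall t \near +oo, measurable_fun setT (Nc t).
  by apply: filterS near_mN => t; exact: measurable_Nc.
have near_mKc : \forall t \near +oo, measurable_fun setT (Kc t).
  by apply: filterS near_mN => t; exact: measurable_Kc.
have l0 : 0 <= l.
  rewrite leNgt; apply/negP => l0.
  have : (P setT <= P set0)%E.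
    apply: le_measure_ae => //; apply: filterS W_cvg => w Ww _.
    have : 0 <= l by apply: (cvgr_to_ge Ww); apply: nearW => n; case/andP: (W01 n w).
    by rewrite leNgt l0.
  by rewrite measure0 probability_setT lee_fin ler10.
have Noo : forall m (e : R), 0 < e ->
    \forall t \near +oo, (P [set w | (N t w < m)%N] <= e%:E)%E.
  apply: (index_diverges_prob c_gt0 c_cvgy mN) => e e0.
  have e20 : 0 < e / 2 by rewrite divr_gt0.
  have [s0 s00 hs0] := small_value_prob mZ Z0 e20.
  have [s [s_gt0 ss0 cs]] := continuity_point_between P' mZ s00.
  exists s => //.
  have := cvg_distr_near mZ NZ cs e20; apply: filterS => t /andP[_ ht].
  apply: (le_trans ht); rewrite lee_fin [leRHS]splitr lerD2r.
  rewrite -lee_fin -probability_leK// (le_trans _ hs0)//.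
  by rewrite probability_le_nondecreasing// ltW.
have WNl : forall e eta : R, 0 < e -> 0 < eta -> \forall t \near +oo,
    (P [set w | (e <= `|W (N t w) w - l|)%R] <= eta%:E)%E.
  by apply: (random_index_prob (L := cst l)) => //; exact: measurable_cst.
apply: (slutsky (V := fun t w => Nc t w * l)) => //.
- exact: measurable_funM.
- apply: filterS near_mNc => t mNct; exact: measurable_funM.
- move=> e eta e0 eta0.
  have eta20 : 0 < eta / 2 by rewrite divr_gt0.
  have eta40 : 0 < eta / 2 / 2 by rewrite divr_gt0.
  (* A continuity point [s] that [Z], hence eventually [Nc t], rarely
     exceeds. *)
  have [b b0 hb] := large_value_prob P' mZ eta40.
  have bb : b < b + 1 by rewrite ltrDl.
  have [s [bs sb cs]] := continuity_point_between P' mZ bb.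
  have s0 : 0 < s by apply: lt_trans bs.
  have es0 : 0 < e / s by rewrite divr_gt0.
  have Fs : 1 - eta / 2 / 2 <= fine (P' (Z @^-1` `]-oo, s])).
    have mZb := measurable_le_cst b mZ.
    apply: (@le_trans _ _ (fine (P' (Z @^-1` `]-oo, b])))); last first.
      by rewrite -lee_fin -!probability_leK// probability_le_nondecreasing// ltW.
    move: hb; rewrite (_ : Z @^-1` `]b, +oo[ = ~` (Z @^-1` `]-oo, b])).
      rewrite probability_setC// probability_leK// -EFinB lee_fin; lra.
    by apply/seteqP; split => w /=; rewrite !in_itv/= andbT ltNge => /negP.
  near=> t.
  have mNt : measurable_fun setT (N t) by near: t; exact: near_mN.
  have mNct : measurable_fun setT (Nc t) by near: t; exact: near_mNc.
  have mKct : measurable_fun setT (Kc t) by near: t; exact: near_mKc.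
  have ct : 0 < c t by near: t; exact: near_c_gt0.
  have mWNt := measurable_WN mW mNt.
  have mNs := measurable_le_cst s mNct.
  have hN : ((fine (P' (Z @^-1` `]-oo, s])) - eta / 2 / 2)%:E <=
      P (Nc t @^-1` `]-oo, s]))%E.
    by near: t; exact: cvg_distr_near_ge.
  have hW : (P [set w | (e / s <= `|W (N t w) w - l|)%R] <= (eta / 2)%:E)%E.
    by near: t; exact: WNl.
  rewrite [eta]splitr; apply: (measure_cover2 _ (measurableC mNs) _ _ _ hW).
  + by apply: measurable_ge_dist => //; exact: measurable_funM.
  + by apply: measurable_ge_dist => //; exact: measurable_cst.
  + apply: aeW => w /=; rewrite in_itv/= => he.
    have [Ns|Ns] := leP (Nc t w) s; [right|by left].
    rewrite ler_pdivrMr//; apply: le_trans he _.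
    have Nc0 : 0 <= Nc t w by rewrite /Nc divr_ge0// ltW.
    by rewrite /Kc -mulrBr normrM ger0_norm// mulrC ler_wpM2l.
  + rewrite probability_setC// probability_leK//; move: hN.
    rewrite [X in (_ <= X)%E]probability_leK// -EFinB !lee_fin; lra.
- exact: cvg_distr_scale.
Unshelve. all: by end_near. Qed.

End random_index_distribution.

(** * The limit theorems *)

Theorem theorem4p2 (R : realType) (d : measure_display)
    (T : measurableType d) (P : probability T R)
    (a : R) (N : R -> T -> nat) (c : R -> R)
    (X : nat -> {RV P >-> R}) (k : nat -> nat)
    (gamma : T -> \bar R) (p : T -> R)
    (ha : 0 < a)
    (hN : forall t : R, 0 <= t -> measurable_fun setT (N t))
    (hc0 : forall t : R, 0 <= t -> 0 < c t)
    (hcoo : c t @[t --> +oo] --> +oo)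
    (hX : strictly_stationary P X)
    (hk : forall n : nat, (1 <= n)%N -> (1 <= k n <= n)%N)
    (hk1 : (k n)%:R / n%:R @[n --> \oo] --> (1 : R))
    (hgamma : is_cond_right_endpoint P (invariant_sets X) (X 1%N) gamma)
    (hp : is_cond_prob P (invariant_sets X)
            [set w | gamma w - a%:E < (X 1%N w)%:E]%E p)
    (hX0 : P [set w | (X 1%N w)%:E = gamma w] = 0%E)
    (hXa : P [set w | (X 1%N w)%:E = (gamma w - a%:E)%E] = 0%E) :
  let L := fun w => (gamma w < +oo)%E%:R * p w in
  let Nc := fun t w => (N t w)%:R / c t in
  let Kc := fun t w => (near_count_process X N k a t w)%:R / c t in
  (* the limit Z is defined on the same probability space *)
  (forall Z : {RV P >-> R}, {ae P, forall w, 0 < Z w} ->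
    let ZL := fun w => Z w * L w in
    [/\ cvg_as P Nc Z -> cvg_as P Kc ZL,
        cvg_prob P Nc Z -> cvg_prob P Kc ZL,
        degenerate P L -> cvg_distr P P Nc Z -> cvg_distr P P Kc ZL &
        degenerate P Z -> cvg_distr P P Nc Z ->
          cvg_prob P Nc Z /\ cvg_prob P Kc ZL])
  /\
  (* the limit in distribution Z is defined on an arbitrary probability space *)
  (forall (d' : measure_display) (T' : measurableType d')
      (P' : probability T' R) (Z : {RV P' >-> R}),
    {ae P', forall w, 0 < Z w} ->
    cvg_distr P P' Nc Z ->
    (forall l : R, {ae P, forall w, L w = l} ->
       cvg_distr P P' Kc (fun w => Z w * l)) /\
    (forall z : R, {ae P', forall w, Z w = z} ->
       cvg_prob P Nc (cst z) /\ cvg_prob P Kc (fun w => z * L w))).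
Proof.
move=> L Nc Kc.
pose W n w : R := (near_count (fun i => X i w) (k n) n a)%:R / n%:R.
have mX n : measurable_fun setT (X n) by exact: measurable_funP.
have W_cvg : {ae P, forall w, W n w @[n --> \oo] --> L w}.
  exact: near_count_frequency_ae hX hk hk1 hgamma hp hX0 hXa.
have mW n : measurable_fun setT (W n).
  apply: measurable_funM; last exact: measurable_cst.
  have [n0|n0] := posnP n; last exact: (measurable_near_count _ _ (hk n n0)).
  rewrite (_ : (fun _ => _) = cst 0); first exact: measurable_cst.
  apply/funext => w; have := near_count_le (fun i => X i w) (k n) n a.
  by rewrite n0 leqn0 => /eqP ->.
have W01 n w : 0 <= W n w <= 1.
  rewrite /W divr_ge0//=; have [->|n0] := posnP n; first by rewrite invr0 mulr0.
  by rewrite ler_pdivrMr ?ltr0n// mul1r ler_nat near_count_le.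
have mL : measurable_fun setT L.
  have wrtm d1 (U : measurableType d1) (f : T -> U) :
      measurable_wrt (invariant_sets X) f -> measurable_fun setT f.
    move=> mf _ B mB; rewrite setTI; exact: (invariant_measurable (mf B mB)).
  have mgamma : measurable_fun setT gamma by apply: wrtm; case: hgamma.
  have mp : measurable_fun setT p by apply: wrtm; case: hp.
  apply: measurable_funM => //.
  rewrite (_ : (fun w => _) = (fun w => if (gamma w < +oo)%E then 1 else 0)); last first.
    by apply/funext => w; case: (_ < _)%E.
  apply: measurable_fun_ifT; [exact: measurable_fun_lte|exact: measurable_cst..].
have KcE : Kc = (fun t w => Nc t w * W (N t w) w).
  apply/funext => t; apply/funext => w; rewrite /Kc /Nc /W /near_count_process.
  set K := near_count _ _ _ _; have [N0|N0] := posnP (N t w).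
    have := near_count_le (fun i => X i w) (k (N t w)) (N t w) a.
    by rewrite -/K N0 leqn0 => /eqP ->; rewrite !mul0r.
  by rewrite [RHS]mulrC mulrA mulfVK// pnatr_eq0 -lt0n.
have mNc : \forall t \near +oo, measurable_fun setT (Nc t).
  near=> t; apply: measurable_Nc; apply: hN; near: t; exact: nbhs_pinfty_ge.
have distr d1 (T1 : measurableType d1) (P1 : probability T1 R) (Z : {RV P1 >-> R}) :
    {ae P1, forall w, 0 < Z w} -> cvg_distr P P1 Nc Z ->
    (forall l : R, {ae P, forall w, L w = l} ->
       cvg_distr P P1 Kc (fun w => Z w * l)) /\
    (forall z : R, {ae P1, forall w, Z w = z} ->
       cvg_prob P Nc (cst z) /\ cvg_prob P Kc (fun w => z * L w)).
  move=> Z0 NZ; have mZ : measurable_fun setT Z by exact: measurable_funP.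
  split=> [l Ll|z Zz].
    rewrite KcE; apply: (cvg_distr_random_index _ hc0 hcoo mW W01 hN mZ Z0 NZ).
    by apply: filterS2 W_cvg Ll => w Ww <-.
  have Ncz : cvg_prob P Nc (cst z) by exact: (cvg_distr_cst mZ mNc Zz NZ).
  split => //; rewrite KcE.
  have z0 : 0 < z.
    rewrite ltNge; apply/negP => z0.
    have : (P1 setT <= P1 set0)%E.
      apply: le_measure_ae => //; apply: filterS2 Z0 Zz => w + Zwz _.
      by rewrite Zwz ltNge z0.
    by rewrite measure0 probability_setT lee_fin ler10.
  apply: (cvg_prob_random_index W_cvg hc0 hcoo mW mL W01 hN (Z := cst z)) => //.
  exact: aeW.
split; last exact: distr.
move=> Z Z0 ZL; have mZ : measurable_fun setT Z by exact: measurable_funP.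
split.
- rewrite KcE; exact: cvg_as_random_index.
- rewrite KcE; exact: (cvg_prob_random_index W_cvg hc0 hcoo mW mL W01 hN mZ Z0).
- move=> [l Ll] NZ; have [hl _] := distr _ _ _ _ Z0 NZ; have NZl := hl l Ll.
  have mZl : measurable_fun setT (fun w => Z w * l) by exact: measurable_funM.
  have mZL : measurable_fun setT ZL by exact: measurable_funM.
  have FE x : P ((fun w => Z w * l) @^-1` `]-oo, x]) = P (ZL @^-1` `]-oo, x]).
    have m1 := measurable_le_cst x mZl; have m2 := measurable_le_cst x mZL.
    by apply/eqP; rewrite eq_le; apply/andP; split; apply: le_measure_ae => //;
      apply: filterS Ll => w Lw; rewrite /= /ZL Lw.
  by rewrite /cvg_distr -(funext FE) => x; rewrite -FE; exact: NZl.
- move=> [z Zz] NZ; have [_ /(_ z Zz)[Ncz _]] := distr _ _ _ _ Z0 NZ.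
  have NcZ : cvg_prob P Nc Z.
    move=> e e0; apply/cvg_measure0P => eta eta0.
    have /cvg_measure0P/(_ eta eta0) Ne := Ncz e e0.
    near=> t; have mNct : measurable_fun setT (Nc t) by near: t.
    apply: (@le_trans _ _ (P [set w | (e <= `|Nc t w - cst z w|)%R])); last by near: t.
    apply: le_measure_ae; [exact: measurable_ge_dist| |].
      by apply: measurable_ge_dist => //; exact: measurable_cst.
    by apply: filterS Zz => w /= ->.
  split => //; rewrite KcE.
  exact: (cvg_prob_random_index W_cvg hc0 hcoo mW mL W01 hN mZ Z0).
Unshelve. all: by end_near. Qed.
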